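(* Every chordal $B_1$-EPG graph is a VPT graph, and the containment is proper: the class of chordal $B_1$-EPG graphs is a proper subclass of the class of VPT graphs.
   Context: All graphs are finite and simple. A graph is chordal if it has no induced cycle of length at least $4$. An EPG representation of a graph $G$ assigns to each vertex $v$ a path $P_v$ in the (rectangular) grid such that two distinct vertices are adjacent in $G$ if and only if their paths share at least one grid edge. A graph is $B_1$-EPG if it has an EPG representation in which every path has at most one bend (change of direction). A graph is VPT if it is the vertex intersection graph of a family of paths in a tree: there is a tree $T$ and paths $P_v$ in $T$, one per vertex, such that two distinct vertices are adjacent if and only if their paths share at least one vertex of $T$. *)

(* Defs.v *)
From mathcomp Require Import all_boot all_order all_algebra.
Set Implicit Arguments.
Unset Strict Implicit.
Unset Printing Implicit Defensive.
Import Order.TTheory GRing.Theory Num.Theory.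

Record sgraph := SGraph {
  vertex :> finType;
  adj : rel vertex;
  adj_sym : symmetric adj;
  adj_irr : irreflexive adj
}.

(* A path (no repeated vertices) is given by its nonempty vertex sequence, in
   either orientation; a single vertex is a path with no edges. *)
Definition is_path (T : eqType) (e : rel T) (s : seq T) : bool :=
  [&& s != [::], sorted e s & uniq s].

(* For [size c >= 3], [c] lists the vertices of a cycle in cyclic order. The
   cycle is induced when adjacent vertices of [c] are consecutive on [c]. *)
Definition induced_cycle (G : sgraph) (c : seq G) : Prop :=
  ucycle (@adj G) c /\
  {in c &, forall x y, adj x y -> next c x = y \/ next c y = x}.

Definition chordal (G : sgraph) : Prop :=
  forall c : seq G, 4 <= size c -> ~ induced_cycle c.

Definition is_tree (T : sgraph) : Prop :=
  [/\ 0 < #|T|,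
      forall x y : T, connect (@adj T) x y
    & forall c : seq T, 3 <= size c -> ~ ucycle (@adj T) c].

Definition gpoint := (int * int)%type.

Definition grid_adj : rel gpoint :=
  fun a b => (`|a.1 - b.1| + `|a.2 - b.2| == 1 :> int)%R.

Definition uses_edge (s : seq gpoint) (a b : gpoint) : bool :=
  infix [:: a; b] s || infix [:: b; a] s.

(* The number of inner vertices [b] of the path, between [a] and [c], where the
   steps [b - a] and [c - b] differ. On a path these steps are unit vectors and
   cannot be opposite, so they differ exactly at a right-angle turn. *)
Fixpoint bends (s : seq gpoint) : nat :=
  match s with
  | a :: ((b :: c :: _) as s') => (b - a != c - b)%R + bends s'
  | _ => 0
  end.

Definition EPG_rep (G : sgraph) (P : G -> seq gpoint) : Prop :=
  (forall v, is_path grid_adj (P v)) /\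
  (forall u v : G, u != v ->
     adj u v <-> exists a b, uses_edge (P u) a b && uses_edge (P v) a b).

Definition Bk_EPG (k : nat) (G : sgraph) : Prop :=
  exists P : G -> seq gpoint, EPG_rep P /\ forall v, bends (P v) <= k.

Definition VPT_rep (G T : sgraph) (P : G -> seq T) : Prop :=
  (forall v, is_path (@adj T) (P v)) /\
  (forall u v : G, u != v ->
     adj u v <-> exists x, (x \in P u) && (x \in P v)).

Definition VPT (G : sgraph) : Prop :=
  exists (T : sgraph) (P : G -> seq T), is_tree T /\ VPT_rep P.

(* Main.v *)
Require Import Defs.
From mathcomp Require Import all_boot all_order all_algebra.
From mathcomp Require Import zify.
Set Implicit Arguments.
Unset Strict Implicit.
Unset Printing Implicit Defensive.
Import Order.TTheory GRing.Theory Num.Theory.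

(** A grid path with at most one bend is a row segment and a column segment with
a common end.  Given a chordal graph with such a representation, cut the grid at
every grid point [p]: the four grid edges at [p] become nodes, joined through two
further nodes, the two sides of [p].  If two paths cross at [p] without sharing
an edge there, the sides separate them; this is consistent, since two different
such separations at one point yield an induced 4-cycle.  Two paths now meet
exactly when they shared a grid edge, they meet in a connected set, and three
pairwise meeting paths have a common node.

The host graph spanned by all the paths is then a forest.  For an edge [e] of the
host, the two sides of [e] on each path [P v] give a potential modulo 2, and the
potentials of two meeting paths differ by a constant on their intersection.
These constants form a cocycle on the given graph, trivial on triangles by the
Helly property, hence trivial on closed walks because the graph is chordal.  A
cycle of the host through [e] would be a closed walk of nonzero weight.

The inclusion is strict: take all the paths between two leaves of a star with
seven leaves, together with the leaves.  Three of the seven pairwise disjoint leaf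
paths cannot use the same grid line, so at least three of them avoid both lines of
any given long path; a long path joining two of these would then have to meet both
on a single line, which is impossible for all three pairs. *)

(** * Consecutive entries of a sequence *)

Definition consec (T : eqType) (s : seq T) (a b : T) : bool :=
  infix [:: a; b] s || infix [:: b; a] s.

Lemma consecC (T : eqType) (s : seq T) a b : consec s a b = consec s b a.
Proof. by rewrite /consec orbC. Qed.

Lemma consec_cons2 (T : eqType) (s : seq T) a b x y :
  consec [:: a, b & s] x y =
  [|| (x == a) && (y == b), (x == b) && (y == a) | consec (b :: s) x y].
Proof.
rewrite /consec !(infix_consl _ a) !prefix_cons !prefix0s !andbT.
move: (infix [:: x; y] _) (infix [:: y; x] _) => i1 i2.
by rewrite -!orbA (andbC (y == a)); congr (_ || _); rewrite orbCA.
Qed.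

Lemma consec1 (T : eqType) (a x y : T) : consec [:: a] x y = false.
Proof. by rewrite /consec !infixs1 /= !eqseq_cons !andbF. Qed.

(** * Cocycles on chordal graphs *)

Section ChordalCocycle.
(** [c] is a 1-cochain with values in Z/2, [bool] under exclusive or. *)
Variables (T : eqType) (e : rel T) (c : T -> T -> bool).
Hypothesis e_sym : symmetric e.
Hypothesis e_irr : irreflexive e.

(** Walks may stall at a vertex, because successive edges of a host walk can lie on the path of the
    same vertex. *)
Definition adj_or_eq (u v : T) : bool := (u == v) || e u v.

Fixpoint walk_sum (u : T) (s : seq T) : bool :=
  if s is v :: s' then c u v (+) walk_sum v s' else false.

Lemma walk_sum_cat u s1 v s2 :
  walk_sum u (s1 ++ v :: s2) = walk_sum u (rcons s1 v) (+) walk_sum v s2.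
Proof. by elim: s1 u => [|w s1 IH] u /=; rewrite ?addbF // IH addbA. Qed.

Lemma walk_sum_rcons u s v : walk_sum u (rcons s v) = walk_sum u s (+) c (last u s) v.
Proof. by elim: s u => [|w s IH] u /=; rewrite ?addbF // IH addbA. Qed.

Hypothesis chG : forall l : seq T, 4 <= size l ->
  ~ (ucycle e l /\ {in l &, forall x y, e x y -> next l x = y \/ next l y = x}).
Hypothesis c_refl : forall u, c u u = false.
Hypothesis c_sym : forall u v, adj_or_eq u v -> c u v = c v u.
Hypothesis c_triangle : forall u v w,
  adj_or_eq u v -> adj_or_eq v w -> adj_or_eq w u -> c u v (+) c v w (+) c w u = false.

Lemma adj_or_eqC u v : adj_or_eq u v = adj_or_eq v u.
Proof. by rewrite /adj_or_eq eq_sym e_sym. Qed.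

Lemma path_adj_or_eq u s : path adj_or_eq u s -> uniq (u :: s) -> path (e) u s.
Proof.
elim: s u => //= v s IH u /andP[uv ps] /and3P[us vs ns].
rewrite IH //= ?vs // andbT.
by move: uv us; rewrite /adj_or_eq inE => /orP[->|].
Qed.

Definition cycle_sum (l : seq T) : bool :=
  if l is u :: s then walk_sum u (rcons s u) else false.

Lemma cycle_sum_cat u s1 v s2 :
  cycle_sum (u :: s1 ++ v :: s2) = walk_sum u (rcons s1 v) (+) walk_sum v (rcons s2 u).
Proof. by rewrite /= rcons_cat walk_sum_cat. Qed.

Lemma cycle_sum_rot n l : cycle_sum (rot n l) = cycle_sum l.
Proof.
rewrite -{2}(cat_take_drop n l) /rot.
case: (take n l) => [|u s1]; first by rewrite cats0.
case: (drop n l) => [|v s2]; first by rewrite cats0.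
by rewrite cat_cons cat_cons !cycle_sum_cat addbC.
Qed.

(** Induction on the length. A closed walk with a repeated vertex, or a cycle with a chord, splits
    into two shorter closed walks; the chord is counted twice and cancels. What remains has at most
    three vertices and is covered by the hypotheses on [c]. *)
Lemma chordal_cycle_sum l : cycle adj_or_eq l -> cycle_sum l = false.
Proof.
have [n] := ubnP (size l); elim: n => // n IHn in l *; rewrite ltnS => ln cl.
have IH l' : size l' < size l -> cycle adj_or_eq l' -> cycle_sum l' = false.
  by move=> ll'; apply: IHn; apply: leq_trans ln.
case: (boolP (uniq l)) => [ul|nul]; last first.
  case: l => // x0 l in ln cl IH nul *.
  have [i [j [ij jl xij]]] := uniqPn x0 nul.
  (* Rotated to start at the first of the two equal entries, the walk is cut at the second one. *)
  have : cycle adj_or_eq (rot i (x0 :: l)) by rewrite rot_cycle.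
  rewrite -(cycle_sum_rot i) /rot (drop_nth x0) ?(ltn_trans ij) //.
  rewrite xij cat_cons; set x := nth _ _ j.
  have xp : x \in drop i.+1 (x0 :: l) ++ take i (x0 :: l).
    by rewrite mem_cat /x -[in nth _ _ j](subnKC ij) -nth_drop mem_nth // size_drop ltn_sub2r ?(leq_ltn_trans ij).
  have : size (drop i.+1 (x0 :: l) ++ take i (x0 :: l)) < size (x0 :: l).
    by have := size_rot i (x0 :: l); rewrite /rot (drop_nth x0) ?(ltn_trans ij) // => <-.
  move: (_ ++ _) xp => p xp; case/splitPr: xp => p1 p2; rewrite size_cat /= => sp.
  rewrite rcons_cat rcons_cons -cat_rcons cat_path last_rcons => /andP[c1 c2].
  rewrite cat_rcons walk_sum_cat.
  have sp1 : size (x :: p1) < (size l).+1 by rewrite /=; lia.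
  have sp2 : size (x :: p2) < (size l).+1 by rewrite /=; lia.
  by have /= -> := IH _ sp1 c1; have /= -> := IH _ sp2 c2.
case: (leqP (size l) 3) => [|l4].
  case: l cl ul {ln IH} => [|u [|v [|w [|? ?]]]] //=; rewrite ?addbF ?andbT ?c_refl //.
    by case/andP=> uv vu _; rewrite (c_sym uv) addbb.
  by case/and3P=> uv vw wu _ _; rewrite addbA; apply: c_triangle.
have adjl : cycle (e) l.
  case: l cl ul l4 {ln IH} => //= u s; rewrite !rcons_path => /andP[ps ls] us s3.
  rewrite path_adj_or_eq //=; move: ls; rewrite /adj_or_eq; case: eqP => // lu.
  by case: s {ps} s3 us lu => //= v s _ /andP[+ _] lu; rewrite -lu mem_last.
(* If the sum were nonzero the cycle would be induced: a chord [x y] would leave two shorter closed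
   walks, both of sum zero by induction. *)
case Fl : (cycle_sum l) => //; case: (chG l4); split; first by rewrite /ucycle adjl.
move=> x y xl yl xy.
case: (eqVneq (next l x) y) => [->|nxy]; first by left.
case: (eqVneq (next l y) x) => [->|nyx]; first by right.
have yx : y != x by apply: contraTneq xy => ->; rewrite e_irr.
have [i p ep] := rot_to xl.
have yp : y \in p.
  by have : y \in rot i l; [rewrite mem_rot|rewrite ep inE (negPf yx)].
have sp : (size p).+1 = size l by rewrite -(size_rot i l) ep.
rewrite -(next_rot i ul) in nxy; rewrite -(next_rot i ul) in nyx.
move: nxy nyx Fl cl ul; rewrite -(cycle_sum_rot i).
rewrite -(rot_cycle i).
rewrite -(rot_uniq i) ep.
case/splitPr: yp sp {ep} => p1 p2 sp nxy nyx; rewrite size_cat /= in sp.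
rewrite cycle_sum_cat /= rcons_cat rcons_cons -cat_rcons cat_path last_rcons.
move=> Fl /andP[c1 c2] ul.
(* As [x] and [y] are not consecutive, both arcs have inner vertices, so closing either arc by the
   chord gives a strictly shorter walk. *)
have p10 : p1 != [::] by apply: contraNneq nxy => p10; rewrite p10 /= eqxx.
have p20 : p2 != [::].
  apply: contraNneq nyx => p20; rewrite p20 in ul *.
  by rewrite -(next_rot (size (x :: p1))) // -cat_cons rot_size_cat /= eqxx.
have xy' : adj_or_eq x y by rewrite /adj_or_eq xy orbT.
have s1 : size (x :: rcons p1 y) < size l.
  by rewrite -sp; case: (p2) p20 => // ? ? _; rewrite /= size_rcons !addnS !ltnS leq_addr.
have s2 : size (y :: rcons p2 x) < size l.
  by rewrite -sp; case: (p1) p10 => // ? ? _; rewrite /= size_rcons !addnS !addSn !ltnS leq_addl.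
have := IH _ s1; have := IH _ s2; rewrite /= !(rcons_path _ _ (rcons _ _)) c1 c2 !last_rcons.
rewrite (adj_or_eqC y x) xy' !(walk_sum_rcons _ (rcons _ _)) !last_rcons => /(_ isT) F2 /(_ isT) F1.
move: Fl F1 F2; rewrite (c_sym xy').
by case: (walk_sum _ _); case: (walk_sum _ _); case: (c y x).
Qed.
End ChordalCocycle.

(** * Representations on a host graph *)

Section Potential.
Variables (N : eqType) (a b : N).

Definition is_edge (x y : N) : bool := (x == a) && (y == b) || (x == b) && (y == a).

(** Tells on which side of the edge [{a, b}] of [s] the node [x] lies; constantly
    [false] when [a] and [b] are not consecutive on [s]. *)
Definition potential (s : seq N) (x : N) : bool :=
  consec s a b && (maxn (index a s) (index b s) <= index x s).

Lemma infix2_index (s : seq N) x y : uniq s -> infix [:: x; y] s ->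
  [/\ x \in s, y \in s & index y s = (index x s).+1].
Proof.
move=> us /infixP[s1 [s2 es]]; move: us; rewrite es => us.
split; rewrite ?mem_cat ?inE ?eqxx ?orbT //.
move: us; rewrite /= cat_uniq => /and3P[_ /norP[xs1 /norP[ys1 _]] /andP[+ _]].
rewrite inE negb_or !index_cat (negPf xs1) (negPf ys1) /= eqxx => /andP[/negPf-> _].
by rewrite eqxx addn0 addn1.
Qed.

Lemma consec_index (s : seq N) x y : uniq s -> consec s x y ->
  [/\ x \in s, y \in s & index y s = (index x s).+1 \/ index x s = (index y s).+1].
Proof. by move=> us /orP[] /(infix2_index us)[? ? ?]; split; auto. Qed.

Lemma eq_index (s : seq N) x y : x \in s -> y \in s -> (x == y) = (index x s == index y s).
Proof.
by move=> xs ys; apply/eqP/eqP => [->//|]; apply: index_inj.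
Qed.

(** Along [s] the potential switches exactly when the edge [{a, b}] is crossed; in terms of indices,
    when the larger of the two is reached. *)
Lemma potential_step (s : seq N) x y : uniq s -> consec s x y ->
  potential s x (+) potential s y = is_edge x y.
Proof.
move=> us xy; have [xs ys ixy] := consec_index us xy; rewrite /potential /is_edge.
case ab : (consec s a b) => /=; last first.
  apply/esym/negbTE/negP => /orP[] /andP[/eqP xa /eqP yb]; move: ab.
    by rewrite -xa -yb xy.
  by rewrite -xa -yb consecC xy.
have [as_ bs iab] := consec_index us ab.
rewrite !(eq_index xs) ?(eq_index ys) //.
move: (index x s) (index y s) (index a s) (index b s) ixy iab {as_ bs xs ys xy ab us}.
by move=> i j k l; lia.
Qed.

End Potential.

Section Host.
Variables (G : sgraph) (N : eqType) (Q : G -> seq N).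
Hypothesis chG : chordal G.
Hypothesis Q_neq0 : forall v, Q v != [::].
Hypothesis Q_uniq : forall v, uniq (Q v).
Hypothesis Q_adj : forall u v, u != v -> adj u v <-> exists x, (x \in Q u) && (x \in Q v).
Hypothesis Q_helly : forall u v w, adj u v -> adj v w -> adj w u ->
  exists x, [&& x \in Q u, x \in Q v & x \in Q w].
(** The intersection of two host paths is connected in their common edges. *)
Hypothesis Q_conn : forall u v (f : N -> bool), u != v ->
  (forall x y, consec (Q u) x y -> consec (Q v) x y -> f x = f y) ->
  {in [predI Q u & Q v] &, forall x y, f x = f y}.

Definition host_adj (x y : N) : bool := [exists v, consec (Q v) x y].

Lemma adj_or_eqP u v :
  reflect (exists x, (x \in Q u) && (x \in Q v)) (adj_or_eq (@adj G) u v).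
Proof.
rewrite /adj_or_eq; apply: (iffP orP) => [[/eqP<-|uv]|[x xuv]].
- by case: (Q u) (Q_neq0 u) => // x s _; exists x; rewrite mem_head.
- by apply/Q_adj => //; apply: contraTneq uv => ->; rewrite adj_irr.
- by case: (eqVneq u v) => [->|uv]; [left | right; apply/Q_adj => //; exists x].
Qed.

Lemma adj_or_eq_helly u v w : adj_or_eq (@adj G) u v -> adj_or_eq (@adj G) v w ->
  adj_or_eq (@adj G) w u -> exists x, [&& x \in Q u, x \in Q v & x \in Q w].
Proof.
move=> uv vw wu; case: (eqVneq u v) => [e|nuv].
  by have /adj_or_eqP[x /andP[xv xw]] := vw; exists x; rewrite e xv.
case: (eqVneq v w) => [e|nvw].
  by have /adj_or_eqP[x /andP[xv xw]] := wu; exists x; rewrite e xv xw.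
case: (eqVneq w u) => [e|nwu].
  by have /adj_or_eqP[x /andP[xv xw]] := uv; exists x; rewrite e xv xw.
move: uv vw wu; rewrite /adj_or_eq (negPf nuv) (negPf nvw) (negPf nwu) /=.
exact: Q_helly.
Qed.

Section Cocycle.
Variables a b : N.

Let pot v := potential a b (Q v).

(** By [Q_conn] the choice of the common node is irrelevant; see [jumpE]. *)
Definition jump (u v : G) : bool :=
  if [seq x <- Q u | x \in Q v] is x :: _ then pot u x (+) pot v x else false.

(** Along a common edge both potentials change by the same amount, so their sum is unchanged and
    [Q_conn] makes it constant on the intersection. *)
Lemma jumpE u v x : x \in Q u -> x \in Q v -> jump u v = pot u x (+) pot v x.
Proof.
move=> xu xv; have : x \in [seq x <- Q u | x \in Q v] by rewrite mem_filter xu xv.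
rewrite /jump; case E : [seq _ <- _ | _] => [//|y s] _.
have : y \in [seq x <- Q u | x \in Q v] by rewrite E mem_head.
rewrite mem_filter => /andP[yv yu].
case: (eqVneq u v) => [->|uv]; first by rewrite !addbb.
have fE : forall z t, consec (Q u) z t -> consec (Q v) z t ->
    pot u z (+) pot v z = pot u t (+) pot v t.
  move=> z t /(potential_step a b (Q_uniq u)) + /(potential_step a b (Q_uniq v)).
  rewrite /pot; case: (is_edge _ _ _ _); do 4!case: (potential _ _ _ _) => //.
by apply: (Q_conn uv fE); rewrite inE /=; apply/andP.
Qed.

(** On a triangle all three jumps can be evaluated at one common node, supplied by the Helly
    property; there each potential occurs twice. *)
Lemma jump_cycle_sum (l : seq G) : cycle (adj_or_eq (@adj G)) l -> cycle_sum jump l = false.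
Proof.
apply: (chordal_cycle_sum (@adj_sym G) (@adj_irr G) chG).
- move=> u; rewrite /jump; case: [seq _ <- _ | _] => // x s; exact: addbb.
- by move=> u v /adj_or_eqP[x /andP[xu xv]]; rewrite !(jumpE (x:=x)) // addbC.
- move=> u v w uv vw wu; have [x /and3P[xu xv xw]] := adj_or_eq_helly uv vw wu.
  by rewrite !(jumpE (x:=x)) //; case: (pot u x); case: (pot v x); case: (pot w x).
Qed.

Fixpoint edge_count (x : N) (s : seq N) : bool :=
  if s is y :: s' then is_edge a b x y (+) edge_count y s' else false.

(** Each step of the host walk lies on some [Q w], and these [w] in order form [l]. A step along
    [Q w] changes the potential by [is_edge], a change from [Q v] to [Q w] changes it by [jump], and
    the total telescopes. *)
Lemma host_walk (x : N) (s : seq N) (v : G) : x \in Q v -> path host_adj x s ->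
  exists l, [/\ path (adj_or_eq (@adj G)) v l, last x s \in Q (last v l) &
    pot v x (+) edge_count x s (+) walk_sum jump v l (+) pot (last v l) (last x s) = false].
Proof.
elim: s x v => [|y s IH] x v xv /=.
  by move=> _; exists [::]; rewrite /= !addbF addbb.
case/andP=> /existsP[w xy] /(IH _ w)[]; first by have [] := consec_index (Q_uniq w) xy.
have [xw yw _] := consec_index (Q_uniq w) xy.
move=> l [pl ls sl]; exists (w :: l); split => //=.
  by rewrite pl andbT; apply/adj_or_eqP; exists x; rewrite xv.
rewrite (jumpE xv xw) -(potential_step a b (Q_uniq w) xy) -/(pot w _) -/(pot w _).
move: sl; case: (pot v x); case: (pot w x); case: (pot w y); case: (edge_count y s);
  case: (walk_sum _ _ _); by case: (pot _ _).
Qed.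

(** The first and the last path both contain [x], so the accompanying walk in [G] closes up and
    [jump_cycle_sum] applies to it. *)
Lemma host_closed_walk (x : N) s : path host_adj x (rcons s x) -> edge_count x (rcons s x) = false.
Proof.
move=> ps; have [v xv] : exists v, x \in Q v.
  case: s ps => [|y s] /= /andP[/existsP[v xy] _]; exists v;
  by have [] := consec_index (Q_uniq v) xy.
have [l [pl ll sl]] := host_walk xv ps; move: ll sl; rewrite last_rcons => ll.
have cl : cycle (adj_or_eq (@adj G)) (v :: l).
  by rewrite /= rcons_path pl; apply/adj_or_eqP; exists x; rewrite ll.
have := jump_cycle_sum cl; rewrite /= walk_sum_rcons (jumpE ll xv).
case: (pot v x); case: (edge_count _ _); case: (walk_sum _ _ _); by case: (pot _ _).
Qed.

End Cocycle.

Lemma edge_count0 a b x s : x != a -> x != b ->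
  all [pred y | (y != a) && (y != b)] (belast x s) -> edge_count a b x s = false.
Proof.
elim: s x => //= y s IH x xa xb /andP[_].
rewrite {1}/is_edge (negPf xa) (negPf xb) /=.
case: s IH => //= z s IH H; apply: IH => //; by case/andP: H => /andP[].
Qed.

Lemma host_acyclic (l : seq N) : 3 <= size l -> ~ ucycle host_adj l.
Proof.
case: l => [|x [|y [|z s]]] //= _ /andP[/= pl /and4P[]].
rewrite !inE !negb_or => /and3P[xy xz xs] /andP[yz ys] zs us.
have yx : path host_adj x (rcons (y :: z :: s) x) by [].
(* The edge being counted is the first one of the cycle; no other step uses it, so the count is
   odd. *)
have := host_closed_walk x y yx; rewrite /= /is_edge !eqxx (negPf xy) /=.
rewrite (eq_sym y x) (negPf xy) (eq_sym z x) (negPf xz) (eq_sym z y) (negPf yz) /= ?andbF /=.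
rewrite edge_count0 // 1?eq_sym //; apply/allP => t; rewrite belast_rcons inE.
case/orP=> [/eqP->|ts] /=; first by rewrite eq_sym xz eq_sym yz.
by apply/andP; split; apply: contraTneq ts => ->.
Qed.

End Host.

(** * Completing a forest to a tree *)

Section Forest.
Variables (X : finType) (e : rel X).
Hypothesis e_sym : symmetric e.
Hypothesis e_irr : irreflexive e.
Hypothesis e_acyclic : forall l : seq X, 3 <= size l -> ~ ucycle e l.

(** The new node [None] is joined to exactly one vertex of each component, its canonical root. *)
Definition rooted_adj (x y : option X) : bool :=
  match x, y with
  | Some x, Some y => e x y
  | None, Some x | Some x, None => roots e x
  | None, None => false
  end.

Lemma rooted_sym : symmetric rooted_adj.
Proof. by case=> [x|] [y|] //=; apply: e_sym. Qed.

Lemma rooted_irr : irreflexive rooted_adj.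
Proof. by case=> [x|] //=; apply: e_irr. Qed.

Definition rooted_forest : sgraph := SGraph rooted_sym rooted_irr.

Lemma path_Some x (s : seq (option X)) : None \notin s -> path rooted_adj (Some x) s ->
  exists2 s', s = map Some s' & path e x s'.
Proof.
elim: s x => [|[y|] s IH] x; rewrite ?inE //=; first by exists [::].
by move=> /(IH y) H /andP[xy /H[s' -> ps]]; exists (y :: s') => //=; rewrite xy.
Qed.

(** A cycle avoiding [None] would be a cycle of the forest. A cycle through [None] leaves and
    re-enters it by two distinct roots joined by a path of the forest, but a component has only one
    root. *)
Lemma rooted_forest_tree : is_tree rooted_forest.
Proof.
have e_con := sym_connect_sym e_sym.
split; first by apply/card_gt0P; exists None.
- have toNone (x : option X) : connect rooted_adj x None.
    case: x => [x|]; last exact: connect0.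
    have xr : connect rooted_adj (Some x) (Some (fingraph.root e x)); last first.
      by apply: connect_trans xr _; apply: connect1; apply: roots_root.
    have /connectP[s ps ->] := connect_root e x.
    elim: s x ps => [|y s IH] x //= /andP[xy ps].
    by apply: connect_trans (IH y ps); apply: connect1.
  by move=> x y; apply: connect_trans (toNone x) _; rewrite (sym_connect_sym rooted_sym).
- move=> l l3 cl; case: (boolP (None \in l)) => [nl|nl]; last first.
    case: l l3 cl nl => [//|[x|]] l l3 /andP[cl ul] nl; last by rewrite mem_head in nl.
    have nl' : None \notin rcons l (Some x) by rewrite mem_rcons.
    have [s es ps] := path_Some nl' cl.
    case/lastP: s es ps => [|s y]; first by case: (l).
    rewrite map_rcons => /rcons_inj[el [exy]] ps; subst y.
    apply: (@e_acyclic (x :: s)); first by rewrite el /= size_map in l3.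
    by rewrite /ucycle /= ps; move: ul; rewrite el -map_cons map_inj_uniq // => ? ? [].
  have [i p ep] := rot_to nl.
  have : ucycle rooted_adj (rot i l) by rewrite rot_ucycle.
  have : 3 <= size (rot i l) by rewrite size_rot.
  rewrite ep => p3 /andP[/= cp /andP[np up]] {l l3 cl nl i ep}.
  case: p p3 cp np up => [|[x|] p] //.
  case/lastP: p => [|p y] // _; rewrite /= rcons_path last_rcons.
  rewrite inE /= => /andP[rx /andP[px ry]] np up.
  have [s es ps] := path_Some np px.
  case/lastP: s es ps => [|s z]; first by case: (p).
  rewrite map_rcons => /rcons_inj[ep ey] ps; rewrite {}ey {}ep {p np px} in ry up.
  have : fingraph.root e x = fingraph.root e z.
    apply/(fingraph.rootP (sym_connect_sym e_sym))/connectP; exists (rcons s z) => //.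
    by rewrite last_rcons.
  rewrite (eqP rx) (eqP ry) => xz; move: up; rewrite xz /= mem_rcons mem_head //.
Qed.

End Forest.

Lemma sorted_consec (T : eqType) (s : seq T) : sorted (consec s) s.
Proof.
elim: s => //= a [|b s] //= IH; rewrite consec_cons2 !eqxx /=.
by apply: sub_path IH => x y xy; rewrite consec_cons2 xy !orbT.
Qed.

(** The nodes that occur on some path form a finite forest, which is completed by [None]. No path
    uses [None], so the intersections are unaffected. *)
Lemma VPT_of_host (G : sgraph) (N : choiceType) (Q : G -> seq N) :
  chordal G ->
  (forall v, Q v != [::]) ->
  (forall v, uniq (Q v)) ->
  (forall u v, u != v -> adj u v <-> exists x, (x \in Q u) && (x \in Q v)) ->
  (forall u v w, adj u v -> adj v w -> adj w u ->
    exists x, [&& x \in Q u, x \in Q v & x \in Q w]) ->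
  (forall u v (f : N -> bool), u != v ->
    (forall x y, consec (Q u) x y -> consec (Q v) x y -> f x = f y) ->
    {in [predI Q u & Q v] &, forall x y, f x = f y}) ->
  VPT G.
Proof.
move=> chG Q0 Qu Qadj Qhelly Qconn.
have acyc := host_acyclic chG Q0 Qu Qadj Qhelly Qconn.
pose all_nodes := flatten [seq Q v | v <- enum G].
pose X := seq_sub all_nodes.
pose e : rel X := relpre val (host_adj Q).
have e_sym : symmetric e by move=> x y; apply: eq_existsb => v; rewrite consecC.
have e_irr : irreflexive e.
  move=> x; apply/existsP => -[v /(consec_index (Qu v))[_ _]].
  by case=> /esym/eqP; rewrite (gtn_eqF (ltnSn _)).
have e_acyclic (l : seq X) : 3 <= size l -> ~ ucycle e l.
  move=> l3 /andP[cl ul]; apply: (acyc (map val l)); first by rewrite size_map.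
  by rewrite /ucycle cycle_map cl map_inj_uniq //; apply: val_inj.
pose P (v : G) : seq X := pmap insub (Q v).
(* Here [insub] drops nothing, since every entry of [Q v] belongs to [all_nodes]. *)
have PE v : map val (P v) = Q v.
  rewrite /P (pmap_filter (insubK _)); apply/all_filterP/allP => x xv.
  rewrite /= isSome_insub; apply/flattenP; exists (Q v) => //.
  by apply: map_f; rewrite mem_enum.
have memP v x : (x \in P v) = (val x \in Q v) by rewrite -PE mem_map //; apply: val_inj.
exists (rooted_forest e_sym e_irr), (fun v => map Some (P v)).
split; first exact: rooted_forest_tree.
split=> [v|u v uv].
  apply/and3P; split.
  - by have := Q0 v; rewrite -PE; case: (P v).
  - rewrite sorted_map; have : sorted (host_adj Q) (map val (P v)).
      rewrite PE; apply: sub_sorted (sorted_consec (Q v)) => x y xy.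
      by apply/existsP; exists v.
    by rewrite sorted_map.
  - rewrite map_inj_uniq; last by move=> ? ? [].
    by rewrite -(map_inj_uniq val_inj) PE.
rewrite Qadj //; split=> [[x /andP[xu xv]]|[[x|] /andP[xu xv]]].
- move: (xu) (xv); rewrite -!PE => /mapP[y yu exy] yv; exists (Some y).
  rewrite !mem_map; try by move=> ? ? [].
  by rewrite yu memP -exy xv.
- exists (val x); move: xu xv; rewrite !mem_map; try by move=> ? ? [].
  by rewrite !memP => -> ->.
- by case/mapP: xu.
Qed.

(** * One-bend grid paths *)

Section Ells.
Local Open Scope ring_scope.

(** The path running along row [cy] from [(ex, cy)] to the corner [(cx, cy)], then
    along column [cx] to [(cx, ey)]; a straight path has [ex = cx] or [ey = cy]. *)
Record ell := Ell {cx : int; cy : int; ex : int; ey : int}.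

(** [onH l i j] and [onV l i j]: [l] uses the grid edge from [(i, j)] to
    [(i + 1, j)], respectively to [(i, j + 1)]. *)
Definition onH (l : ell) (i j : int) : bool :=
  (j == cy l) && ((cx l <= i) && (i < ex l) || (ex l <= i) && (i < cx l)).
Definition onV (l : ell) (i j : int) : bool :=
  (i == cx l) && ((cy l <= j) && (j < ey l) || (ey l <= j) && (j < cy l)).

Definition ell_edge (l : ell) (a b : gpoint) : bool :=
  [|| (a.2 == b.2) && ((b.1 == a.1 + 1) && onH l a.1 a.2 || (a.1 == b.1 + 1) && onH l b.1 b.2)
    | (a.1 == b.1) && ((b.2 == a.2 + 1) && onV l a.1 a.2 || (a.2 == b.2 + 1) && onV l b.1 b.2)].

(** For [ell_of_path], which builds an ell from a point by adding unit edges one at a time. *)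
Lemma ell_edge_addV (l l' : ell) (p q : int) :
  (forall i j, onH l' i j = onH l i j) ->
  (forall i j, onV l' i j = onV l i j || (i == p) && (j == q)) ->
  forall x y, ell_edge l' x y = [|| (x == (p, q)) && (y == (p, q + 1)),
    (x == (p, q + 1)) && (y == (p, q)) | ell_edge l x y].
Proof.
move=> eH eV [x1 x2] [y1 y2]; rewrite /ell_edge !eH !eV !xpair_eqE /=.
move: (onH l _ _) (onH l _ _) (onV l _ _) (onV l _ _) => h1 h2 v1 v2; lia.
Qed.

Lemma ell_edge_addH (l l' : ell) (p q : int) :
  (forall i j, onV l' i j = onV l i j) ->
  (forall i j, onH l' i j = onH l i j || (i == p) && (j == q)) ->
  forall x y, ell_edge l' x y = [|| (x == (p, q)) && (y == (p + 1, q)),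
    (x == (p + 1, q)) && (y == (p, q)) | ell_edge l x y].
Proof.
move=> eV eH [x1 x2] [y1 y2]; rewrite /ell_edge !eH !eV !xpair_eqE /=.
move: (onH l _ _) (onH l _ _) (onV l _ _) (onV l _ _) => h1 h2 v1 v2; lia.
Qed.

Lemma ell_edge_point (x y : int) a b : ell_edge (Ell x y x y) a b = false.
Proof. rewrite /ell_edge /onH /onV /=; lia. Qed.

(** Edges are added from the last to the first. The induction records which arm carries the first
    edge of the path and that this edge points from the end of the arm towards the corner. *)
Lemma ell_of_path (s : seq gpoint) :
  is_path grid_adj s -> (bends s <= 1)%N -> exists l, forall a b, uses_edge s a b = ell_edge l a b.
Proof.
case: s => [//|a s] /and3P[_ srt un].
case: s srt un => [|b s] srt un.
  move=> _; exists (Ell a.1 a.2 a.1 a.2) => x y.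
  by rewrite (consec1 a x y : uses_edge [:: a] x y = false) ell_edge_point.
(* [k] bounds the number of bends; for [k = 0] the second segment is degenerate,
   so its corner can be moved to the other end when a bend is added. *)
suff H : forall k : nat, (bends (a :: b :: s) <= k <= 1)%N -> exists l,
    [/\ forall x y, consec (a :: b :: s) x y = ell_edge l x y
      & [/\ a = (ex l, cy l), b.2 = cy l,
          b.1 = ex l + 1 /\ ex l < cx l \/ b.1 = ex l - 1 /\ cx l < ex l & (k = 0%N -> ey l = cy l)] \/
        [/\ a = (cx l, ey l), b.1 = cx l,
          b.2 = ey l + 1 /\ ey l < cy l \/ b.2 = ey l - 1 /\ cy l < ey l & (k = 0%N -> ex l = cx l)]].
  move=> le1; have [|l [Hl _]] := H 1%N; first by rewrite le1.
  by exists l => x y; rewrite -Hl.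
elim: s a b srt un => [|c s IH] [a1 a2] [b1 b2] srt un k.
  move=> _; move: srt => /=; rewrite /grid_adj /= andbT => ab.
  have [e|[e|[e|e]]] : (b1 = a1 + 1 /\ b2 = a2) \/ (a1 = b1 + 1 /\ b2 = a2) \/
    (b1 = a1 /\ b2 = a2 + 1) \/ (b1 = a1 /\ a2 = b2 + 1) by lia.
  - case: e => -> ->; exists (Ell (a1 + 1) a2 a1 a2); split; last by left; split=> //=; left; split; lia.
    move=> x y; rewrite consec_cons2 consec1 -(ell_edge_point a1 a2 x y).
    by symmetry; apply: ell_edge_addH => i j; rewrite /onH /onV /=; lia.
  - case: e => -> ->; exists (Ell b1 a2 (b1 + 1) a2); split; last by left; split=> //=; right; split; lia.
    move=> x y; rewrite consec_cons2 consec1 -(ell_edge_point b1 a2 x y) orbCA.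
    by symmetry; apply: ell_edge_addH => i j; rewrite /onH /onV /=; lia.
  - case: e => -> ->; exists (Ell a1 (a2 + 1) a1 a2); split; last by right; split=> //=; left; split; lia.
    move=> x y; rewrite consec_cons2 consec1 -(ell_edge_point a1 a2 x y).
    by symmetry; apply: ell_edge_addV => i j; rewrite /onH /onV /=; lia.
  - case: e => -> ->; exists (Ell a1 b2 a1 (b2 + 1)); split; last by right; split=> //=; right; split; lia.
    move=> x y; rewrite consec_cons2 consec1 -(ell_edge_point a1 b2 x y) orbCA.
    by symmetry; apply: ell_edge_addV => i j; rewrite /onH /onV /=; lia.
move: c srt un IH => [c1 c2] srt un IH hk.
have srt' : sorted grid_adj [:: (b1, b2), (c1, c2) & s] by case/andP: srt.
have un' : uniq [:: (b1, b2), (c1, c2) & s] by case/andP: un.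
have ab : grid_adj (a1, a2) (b1, b2) by case/andP: srt.
(* Excludes a step back, so that a change of step is a right-angle turn. *)
have ac : (a1, a2) != (c1, c2) by apply: contraTneq un => ->; rewrite /= !inE eqxx orbT.
move Ed : ((b1 - a1 != c1 - b1) || (b2 - a2 != c2 - b2)) => d.
have hk' : (d + bends [:: (b1, b2), (c1, c2) & s] <= k <= 1)%N.
  by move: hk; rewrite -Ed -negb_and.
have bk : (bends [:: (b1, b2), (c1, c2) & s] <= (k - d) <= 1)%N by lia.
have [l [Hl El]] := IH (b1, b2) (c1, c2) srt' un' _ bk.
move: ab ac; rewrite /grid_adj xpair_eqE /= => ab ac; case: d Ed bk hk' El => bend bk hk' El.
  have kd : (k - true = 0)%N by lia.
  have k1 : k <> 0%N by lia.
  (* The rest of the path is straight, so exchanging its corner with its far end puts the corner at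
     [b]; the new edge becomes the other arm. *)
  case: El => -[[eb1 eb2]] /= ec1 ec2 /(_ kd) es; clear kd hk hk' bk IH srt srt' un un'.
    have [e|e] : b2 = a2 + 1 \/ a2 = b2 + 1 by lia.
      exists (Ell (ex l) (cy l) (cx l) a2); split; last by right; split=> /=; [congr pair| | |]; lia.
      move=> x y; rewrite consec_cons2 Hl.
      have -> : b1 = a1 by lia.
      rewrite e; symmetry; apply: ell_edge_addV => i j; rewrite /onH /onV /=; lia.
    exists (Ell (ex l) (cy l) (cx l) a2); split; last by right; split=> /=; [congr pair| | |]; lia.
    move=> x y; rewrite consec_cons2 Hl orbCA.
    have -> : b1 = a1 by lia.
    rewrite e; symmetry; apply: ell_edge_addV => i j; rewrite /onH /onV /=; lia.
  have [e|e] : b1 = a1 + 1 \/ a1 = b1 + 1 by lia.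
    exists (Ell (cx l) (ey l) a1 (cy l)); split; last by left; split=> /=; [congr pair| | |]; lia.
    move=> x y; rewrite consec_cons2 Hl.
    have -> : b2 = a2 by lia.
    rewrite e; symmetry; apply: ell_edge_addH => i j; rewrite /onH /onV /=; lia.
  exists (Ell (cx l) (ey l) a1 (cy l)); split; last by left; split=> /=; [congr pair| | |]; lia.
  move=> x y; rewrite consec_cons2 Hl orbCA.
  have -> : b2 = a2 by lia.
  rewrite e; symmetry; apply: ell_edge_addH => i j; rewrite /onH /onV /=; lia.
(* Without a bend the new edge lengthens the arm that starts at [b]. *)
rewrite subn0 in El; case: El => -[[eb1 eb2]] /= ec1 ec2 es; clear hk hk' bk IH srt srt' un un'.
  have eab : b2 = a2 by lia.
  exists (Ell (cx l) (cy l) a1 (ey l)); split; last by left; split=> /=; [congr pair| | |]; lia.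
  move=> x y; rewrite consec_cons2 Hl eab.
  have [e|e] : b1 = a1 + 1 \/ a1 = b1 + 1 by lia.
    rewrite e; symmetry; apply: ell_edge_addH => i j; rewrite /onH /onV /=; lia.
  rewrite orbCA e; symmetry; apply: ell_edge_addH => i j; rewrite /onH /onV /=; lia.
have eab : b1 = a1 by lia.
exists (Ell (cx l) (cy l) (ex l) a2); split; last by right; split=> /=; [congr pair| | |]; lia.
move=> x y; rewrite consec_cons2 Hl eab.
have [e|e] : b2 = a2 + 1 \/ a2 = b2 + 1 by lia.
  rewrite e; symmetry; apply: ell_edge_addV => i j; rewrite /onH /onV /=; lia.
rewrite orbCA e; symmetry; apply: ell_edge_addV => i j; rewrite /onH /onV /=; lia.
Qed.

Lemma ell_edgeC l a b : ell_edge l a b = ell_edge l b a.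
Proof.
by rewrite /ell_edge (eq_sym a.2 b.2) (eq_sym a.1 b.1); congr (_ && _ || _ && _); rewrite orbC.
Qed.

Lemma ell_edgeH l i j : ell_edge l (i, j) (i + 1, j) = onH l i j.
Proof.
by rewrite /ell_edge /=; move: (onH l _ _) (onH l _ _) (onV l _ _) (onV l _ _) => ? ? ? ?; lia.
Qed.

Lemma ell_edgeV l i j : ell_edge l (i, j) (i, j + 1) = onV l i j.
Proof.
by rewrite /ell_edge /=; move: (onH l _ _) (onH l _ _) (onV l _ _) (onV l _ _) => ? ? ? ?; lia.
Qed.

Lemma ell_edge_grid_adj l a b : ell_edge l a b -> grid_adj a b.
Proof. by case: a b => [a1 a2] [b1 b2]; rewrite /ell_edge /grid_adj /=; lia. Qed.

Lemma grid_edge_ind (P : gpoint -> gpoint -> Prop) :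
  (forall a b, P a b -> P b a) ->
  (forall i j, P (i, j) (i + 1, j)) -> (forall i j, P (i, j) (i, j + 1)) ->
  forall a b, grid_adj a b -> P a b.
Proof.
move=> Psym PH PV [a1 a2] [b1 b2]; rewrite /grid_adj /= => ab.
have [[-> ->]|[[-> ->]|[[-> ->]|[-> ->]]]] : (b1 = a1 + 1 /\ b2 = a2) \/ (a1 = b1 + 1 /\ b2 = a2) \/
    (b1 = a1 /\ b2 = a2 + 1) \/ (b1 = a1 /\ a2 = b2 + 1) by lia.
- exact: PH. - by apply: Psym; apply: PH. - exact: PV. - by apply: Psym; apply: PV.
Qed.

(** * Common edges of one-bend paths *)

Definition share (l m : ell) : Prop :=
  (exists i j, onH l i j && onH m i j) \/ (exists i j, onV l i j && onV m i j).

Lemma ell_edge_share (l m : ell) :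
  (exists a b, ell_edge l a b && ell_edge m a b) <-> share l m.
Proof.
split=> [[a [b]]|[[i [j hij]]|[i [j hij]]]].
- case/andP=> la; have := la; have := ell_edge_grid_adj la; move: a b {la}.
  apply: grid_edge_ind => [a b|i j|i j]; rewrite ?(ell_edgeC _ b) ?ell_edgeH ?ell_edgeV //.
    by move=> hl hm; left; exists i, j; rewrite hl.
  by move=> hl hm; right; exists i, j; rewrite hl.
- by exists (i, j), (i + 1, j); rewrite !ell_edgeH.
- by exists (i, j), (i, j + 1); rewrite !ell_edgeV.
Qed.

(** Reflection in the diagonal, which carries statements about rows over to columns. *)
Definition flip (l : ell) : ell := Ell (cy l) (cx l) (ey l) (ex l).

Lemma share_flip l m : share (flip l) (flip m) <-> share l m.
Proof.
by split=> -[[i [j ij]]|[i [j ij]]]; [right|left|right|left]; exists j, i.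
Qed.

Lemma shareC l m : share l m <-> share m l.
Proof. by split=> -[[i [j ij]]|[i [j ij]]]; [left|right|left|right]; exists i, j; rewrite andbC. Qed.

Lemma ell_edge_dir l q p : ell_edge l q p ->
  [\/ q = (p.1 + 1, p.2) /\ onH l p.1 p.2, q = (p.1 - 1, p.2) /\ onH l (p.1 - 1) p.2,
      q = (p.1, p.2 + 1) /\ onV l p.1 p.2 | q = (p.1, p.2 - 1) /\ onV l p.1 (p.2 - 1)].
Proof.
move=> lqp; have := lqp; have := ell_edge_grid_adj lqp; move: q p {lqp}.
suff H q p : grid_adj q p -> (ell_edge l q p ->
  [\/ q = (p.1 + 1, p.2) /\ onH l p.1 p.2, q = (p.1 - 1, p.2) /\ onH l (p.1 - 1) p.2,
      q = (p.1, p.2 + 1) /\ onV l p.1 p.2 | q = (p.1, p.2 - 1) /\ onV l p.1 (p.2 - 1)]) /\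
  (ell_edge l p q ->
  [\/ p = (q.1 + 1, q.2) /\ onH l q.1 q.2, p = (q.1 - 1, q.2) /\ onH l (q.1 - 1) q.2,
      p = (q.1, q.2 + 1) /\ onV l q.1 q.2 | p = (q.1, q.2 - 1) /\ onV l q.1 (q.2 - 1)]).
  by move=> q p /H[].
move: q p; apply: grid_edge_ind => [q p [? ?]|i j|i j]; first by split.
- split; rewrite 1?[ell_edge l (_ + 1, _) _]ell_edgeC ell_edgeH /= => h; last exact: Or41.
  by apply: Or42; rewrite addrK.
- split; rewrite 1?[ell_edge l (_, _ + 1) _]ell_edgeC ell_edgeV /= => h; last exact: Or43.
  by apply: Or44; rewrite addrK.
Qed.

(** The two pairs are all four grid edges at [p]. Either one path runs straight along its row and
    the other along its column, and then their rows differ and their columns differ; or both have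
    their corner at [p] with arms in different directions. *)
Lemma ell_cross l m p a b c d : uniq [:: a; b; c; d] ->
  ell_edge l a p -> ell_edge l b p -> ell_edge m c p -> ell_edge m d p -> ~ share l m.
Proof.
rewrite /= !inE !negb_or -!andbA => /and5P[ab ac ad bc /and3P[bd cd _]].
move=> /ell_edge_dir ha /ell_edge_dir hb /ell_edge_dir hc /ell_edge_dir hd sh.
case: ha ab ac ad => -[-> ha]; case: hb bc bd => -[-> hb]; rewrite ?eqxx //;
  case: hc cd => -[-> hc]; rewrite ?eqxx //; case: hd => -[-> hd]; rewrite ?eqxx // => _ _ _ _ _ _;
  case: sh => -[i [j /andP[hi hj]]]; move: ha hb hc hd hi hj; rewrite /onH /onV; clear; lia.
Qed.

(** The common edges of two one-bend paths are connected: those in one line form an interval, and a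
    common horizontal edge together with a common vertical one forces a common corner, where the two
    intervals meet. *)
Lemma ell_chain (l m : ell) (T : Type) (g : gpoint -> gpoint -> T) :
  (forall a b, g a b = g b a) ->
  (forall a p b, a != b -> ell_edge l a p && ell_edge m a p ->
    ell_edge l p b && ell_edge m p b -> g a p = g p b) ->
  forall a b c d, ell_edge l a b && ell_edge m a b -> ell_edge l c d && ell_edge m c d ->
  g a b = g c d.
Proof.
move=> gC gstep.
have nS (x : int) n : x + n.+1%:Z = x + n%:Z + 1 by clear; lia.
pose gH i j := g (i, j) (i + 1, j); pose gV i j := g (i, j) (i, j + 1).
have runH i n j : onH l i j && onH m i j -> onH l (i + n%:Z) j && onH m (i + n%:Z) j ->
    gH i j = gH (i + n%:Z) j.
  move=> h0; elim: n => [|n IH] hn; first by rewrite addr0.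
  have hn' : onH l (i + n%:Z) j && onH m (i + n%:Z) j.
    by move: h0 hn; clear; rewrite /onH; lia.
  rewrite (IH hn') /gH nS; rewrite nS in hn.
  by apply: gstep; rewrite ?ell_edgeH // xpair_eqE; clear; lia.
have runV i n j : onV l i j && onV m i j -> onV l i (j + n%:Z) && onV m i (j + n%:Z) ->
    gV i j = gV i (j + n%:Z).
  move=> h0; elim: n => [|n IH] hn; first by rewrite addr0.
  have hn' : onV l i (j + n%:Z) && onV m i (j + n%:Z).
    by move: h0 hn; clear; rewrite /onV; lia.
  rewrite (IH hn') /gV nS; rewrite nS in hn.
  by apply: gstep; rewrite ?ell_edgeV // xpair_eqE; clear; lia.
have eqHH i j i' j' : onH l i j && onH m i j -> onH l i' j' && onH m i' j' -> gH i j = gH i' j'.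
  move=> h h'; have ej : j' = j by move: h h'; clear; rewrite /onH; lia.
  rewrite {}ej in h' *; have [le|le] := lerP i i'.
    have e : i' = i + `|i' - i|%N%:Z by move: le; clear; lia.
    by rewrite e; apply: runH; rewrite -?e.
  have e : i = i' + `|i - i'|%N%:Z by move: le; clear; lia.
  by rewrite e; symmetry; apply: runH; rewrite -?e.
have eqVV i j i' j' : onV l i j && onV m i j -> onV l i' j' && onV m i' j' -> gV i j = gV i' j'.
  move=> h h'; have ej : i' = i by move: h h'; clear; rewrite /onV; lia.
  rewrite {}ej in h' *; have [le|le] := lerP j j'.
    have e : j' = j + `|j' - j|%N%:Z by move: le; clear; lia.
    by rewrite e; apply: runV; rewrite -?e.
  have e : j = j' + `|j - j'|%N%:Z by move: le; clear; lia.
  by rewrite e; symmetry; apply: runV; rewrite -?e.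
have eqHV i j i' j' : onH l i j && onH m i j -> onV l i' j' && onV m i' j' -> gH i j = gV i' j'.
  (* The common corner is [(x, y)]; [x'] and [y'] are the coordinates of the common edges next to
     it. *)
  move=> h h'; pose x := i'; pose y := j.
  pose x' := if x <= i then x else x - 1; pose y' := if y <= j' then y else y - 1.
  have hx : onH l x' y && onH m x' y.
    by move: h h'; rewrite /x' /x /y /onH /onV; clear; case: ifP; lia.
  have hy : onV l x y' && onV m x y'.
    by move: h h'; rewrite /y' /x /y /onH /onV; clear; case: ifP; lia.
  rewrite (eqHH _ _ _ _ h hx) (eqVV _ _ _ _ h' hy) /gH /gV.
  have ne (s t : int) : (s = x + 1 \/ s = x - 1) -> (s, y) != (x, t).
    by rewrite xpair_eqE; lia.
  move: hx hy; rewrite /x' /y'; case: ifP => _; case: ifP => _; rewrite ?subrK => hx hy.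
  - rewrite gC; apply: gstep; rewrite ?ell_edgeV //; first by apply: ne; left.
    by rewrite ![ell_edge _ (x + 1, _) _]ell_edgeC !ell_edgeH.
  - rewrite gC [RHS]gC; apply: gstep; first by apply: ne; left.
      by rewrite ![ell_edge _ (x + 1, _) _]ell_edgeC !ell_edgeH.
    by rewrite ![ell_edge _ (x, y) _]ell_edgeC -{2 4}(subrK 1 y) !ell_edgeV.
  - apply: gstep; rewrite ?ell_edgeV //; first by apply: ne; right.
    by rewrite -{2 4}(subrK 1 x) !ell_edgeH.
  - rewrite [RHS]gC; apply: gstep; first by apply: ne; right.
      by rewrite -{2 4}(subrK 1 x) !ell_edgeH.
    by rewrite ![ell_edge _ (x, y) _]ell_edgeC -{2 4}(subrK 1 y) !ell_edgeV.
have gen a b : grid_adj a b -> ell_edge l a b && ell_edge m a b ->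
    (exists i j, onH l i j && onH m i j /\ g a b = gH i j) \/
    (exists i j, onV l i j && onV m i j /\ g a b = gV i j).
  move: a b; apply: grid_edge_ind => [a b IH|i j|i j].
  - by rewrite ![ell_edge _ b a]ell_edgeC gC.
  - by rewrite !ell_edgeH => h; left; exists i, j.
  - by rewrite !ell_edgeV => h; right; exists i, j.
move=> a b c d hab hcd.
have gab : grid_adj a b by case/andP: hab => /ell_edge_grid_adj.
have gcd : grid_adj c d by case/andP: hcd => /ell_edge_grid_adj.
case: (gen _ _ gab hab) (gen _ _ gcd hcd) => -[i [j [h ->]]] [] [i' [j' [h' ->]]].
- exact: eqHH. - exact: eqHV. - by symmetry; apply: eqHV. - exact: eqVV.
Qed.

(** Three pairwise sharing paths share a common edge, or each of them uses two
    edges of a claw centred at [p]. *)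
Definition ell_meet (l m k : ell) : Prop :=
  (exists a b, [&& ell_edge l a b, ell_edge m a b & ell_edge k a b]) \/
  (exists p a b c, [/\ a != b, b != c & c != a] /\
    [/\ ell_edge l a p && ell_edge l p b, ell_edge m b p && ell_edge m p c
      & ell_edge k c p && ell_edge k p a]).

Lemma ell_meet_rot l m k : ell_meet l m k -> ell_meet m k l.
Proof.
case=> [[a [b /and3P[h1 h2 h3]]]|[p [a [b [c [[ab bc ca] [h1 h2 h3]]]]]]].
  by left; exists a, b; rewrite h1 h2 h3.
by right; exists p, b, c, a.
Qed.

Definition swap (a : gpoint) : gpoint := (a.2, a.1).

Lemma ell_edge_flip l a b : ell_edge (flip l) a b = ell_edge l (swap a) (swap b).
Proof. by rewrite /ell_edge orbC. Qed.

Lemma ell_meet_flip l m k : ell_meet (flip l) (flip m) (flip k) -> ell_meet l m k.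
Proof.
have swap_inj a b : a != b -> swap a != swap b.
  by case: a b => [a1 a2] [b1 b2]; rewrite !xpair_eqE andbC.
case=> [[a [b]]|[p [a [b [c [[ab bc ca]]]]]]]; rewrite !ell_edge_flip => h.
  by left; exists (swap a), (swap b).
by right; exists (swap p), (swap a), (swap b), (swap c); split => //; split; apply: swap_inj.
Qed.

(** Helly property of intervals: all edges lie in one row, and the middle one of the three given
    edges belongs to all three paths. *)
Lemma ell_meetHHH l m k i1 i2 i3 j1 j2 j3 :
  onH l i1 j1 && onH m i1 j1 -> onH m i2 j2 && onH k i2 j2 -> onH k i3 j3 && onH l i3 j3 ->
  ell_meet l m k.
Proof.
move=> h1 h2 h3; left.
have : [|| onH k i1 j1, onH l i2 j2 | onH m i3 j3] by move: h1 h2 h3; rewrite /onH; clear; lia.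
case/or3P => h.
- by exists (i1, j1), (i1 + 1, j1); rewrite !ell_edgeH h andbT.
- by exists (i2, j2), (i2 + 1, j2); rewrite !ell_edgeH h.
- by exists (i3, j3), (i3 + 1, j3); rewrite !ell_edgeH h andbC.
Qed.

(** Here [k] and [l] have the same corner. If no edge is common to all three, their row arms leave
    it in opposite directions, and [m] runs straight through it along the row: this is the claw. *)
Lemma ell_meetHHV l m k i1 i2 i3 j1 j2 j3 :
  onH l i1 j1 && onH m i1 j1 -> onH m i2 j2 && onH k i2 j2 -> onV k i3 j3 && onV l i3 j3 ->
  ell_meet l m k.
Proof.
move=> h1 h2 h3.
have [hl|nl] := boolP (onH l i2 j2).
  by left; exists (i2, j2), (i2 + 1, j2); rewrite !ell_edgeH hl.
have [hk|nk] := boolP (onH k i1 j1).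
  by left; exists (i1, j1), (i1 + 1, j1); rewrite !ell_edgeH hk andbT.
have ej : j2 = j1 by move: h1 h2; rewrite /onH; clear; lia.
rewrite {}ej in h2 nl; right; exists (i3, j1).
(* The neighbour of the corner on the column arm shared by [k] and [l]. *)
pose a := if j1 <= j3 then (i3, j1 + 1) else (i3, j1 - 1).
have ha : ell_edge k (i3, j1) a && ell_edge l a (i3, j1).
  rewrite (ell_edgeC l) /a; case: ifP => le; rewrite ?ell_edgeV.
    by move: h1 h2 h3 le; rewrite /onH /onV; clear; lia.
  rewrite ![ell_edge _ (_, j1) _]ell_edgeC -{2 4}(subrK 1 j1) !ell_edgeV.
  by move: h1 h2 h3 le; rewrite /onH /onV; clear; lia.
have eW n : ell_edge n (i3 - 1, j1) (i3, j1) = onH n (i3 - 1) j1.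
  by rewrite -{2}(subrK 1 i3) ell_edgeH.
have ne : [/\ a != (i3 - 1, j1), a != (i3 + 1, j1) & (i3 - 1, j1) != (i3 + 1, j1) :> gpoint].
  by rewrite /a; case: ifP => _; rewrite !xpair_eqE; clear; split; lia.
case: ne => n1 n2 n3; case/andP: ha => ka la.
have [lt|le] := ltP i1 i3.
  exists a, (i3 - 1, j1), (i3 + 1, j1); split; first by rewrite n1 n3 eq_sym.
  rewrite ka la ![ell_edge _ (i3, j1) (i3 - 1, j1)]ell_edgeC ![ell_edge _ (i3 + 1, j1) _]ell_edgeC.
  rewrite !eW !ell_edgeH.
  by move: h1 h2 h3 nl nk lt; rewrite /onH /onV; clear; split; lia.
exists a, (i3 + 1, j1), (i3 - 1, j1); split; first by rewrite n2 eq_sym n3 eq_sym.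
rewrite ka la ![ell_edge _ (i3, j1) (i3 - 1, j1)]ell_edgeC ![ell_edge _ (i3 + 1, j1) _]ell_edgeC.
rewrite !eW !ell_edgeH.
by move: h1 h2 h3 nl nk le; rewrite /onH /onV; clear; split; lia.
Qed.

Lemma ell_helly l m k : share l m -> share m k -> share k l -> ell_meet l m k.
Proof.
have VVH l' m' k' i1 i2 i3 j1 j2 j3 : onV l' i1 j1 && onV m' i1 j1 ->
    onV m' i2 j2 && onV k' i2 j2 -> onH k' i3 j3 && onH l' i3 j3 -> ell_meet l' m' k'.
  by move=> h1 h2 h3; apply: ell_meet_flip; apply: (@ell_meetHHV _ _ _ j1 j2 j3 i1 i2 i3).
case=> -[i1 [j1 h1]] [] [i2 [j2 h2]] [] [i3 [j3 h3]].
- exact: ell_meetHHH h1 h2 h3.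
- exact: ell_meetHHV h1 h2 h3.
- by apply: ell_meet_rot; apply: ell_meetHHV h3 h1 h2.
- by do 2!apply: ell_meet_rot; apply: VVH h2 h3 h1.
- by do 2!apply: ell_meet_rot; apply: ell_meetHHV h2 h3 h1.
- by apply: ell_meet_rot; apply: VVH h3 h1 h2.
- exact: VVH h1 h2 h3.
- by apply: ell_meet_flip; apply: (@ell_meetHHH _ _ _ j1 j2 j3 i1 i2 i3).
Qed.

(** The row arms and the corners of [la] and [lc] lie on opposite sides of the edge [ib]. Two column
    contacts would need equal columns; with at least one row contact, the row arm of [k] extends
    across [ib] and meets [lb]. *)
Lemma share_betweenH (la lb lc k : ell) (ia ib ic r : int) :
  onH la ia r -> onH lb ib r -> onH lc ic r -> ia < ib -> ib < ic ->
  ~ share la lb -> ~ share lb lc -> ~ share k lb -> share k la -> share k lc -> False.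
Proof.
move=> ha hb hc ab bc nab nbc nkb.
have nha : ~~ onH la ib r by apply/negP => h; apply: nab; left; exists ib, r; rewrite h.
have nhc : ~~ onH lc ib r by apply/negP => h; apply: nbc; left; exists ib, r; rewrite hb.
have nhk : ~~ onH k ib r by apply/negP => h; apply: nkb; left; exists ib, r; rewrite h.
case=> -[i1 [j1 /andP[]]] + + [] [i2 [j2 /andP[]]]; clear nab nbc nkb.
- move: ha hb hc nha nhc nhk; rewrite /onH /onV; lia.
- move: ha hb hc nha nhc nhk; rewrite /onH /onV; lia.
- move: ha hb hc nha nhc nhk; rewrite /onH /onV; lia.
- move: ha hb hc nha nhc nhk; rewrite /onH /onV; lia.
Qed.

Definition has_row (l : ell) (r : int) : bool := (r == cy l) && (cx l != ex l).

Lemma has_rowP l r : reflect (exists i, onH l i r) (has_row l r).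
Proof.
apply: (iffP andP) => [[rl ne]|[i]]; last by rewrite /onH; lia.
by exists (Num.min (cx l) (ex l)); rewrite /onH rl; lia.
Qed.

Lemma share_line l m : share l m ->
  [/\ cy l = cy m, has_row l (cy l) & has_row m (cy m)] \/
  [/\ cx l = cx m, has_row (flip l) (cx l) & has_row (flip m) (cx m)].
Proof.
case=> -[i [j /andP[]]]; rewrite /has_row /onH /onV /= => hl hm; [left|right]; split; lia.
Qed.

End Ells.

(** * The host of a chordal one-bend representation *)

Lemma consec_mem (T : eqType) (s : seq T) a b : consec s a b -> (a \in s) && (b \in s).
Proof. by case/orP => /infixP[s1 [s2 ->]]; rewrite !mem_cat !inE !eqxx !orbT. Qed.

Lemma consec_cons (T : eqType) x (s : seq T) a b : consec s a b -> consec (x :: s) a b.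
Proof. by case/orP => h; rewrite /consec !infix_consl h !orbT. Qed.

Lemma consec_cat (T : eqType) s1 (s : seq T) a b : consec s a b -> consec (s1 ++ s) a b.
Proof. by move=> ab; elim: s1 => //= x s1; apply: consec_cons. Qed.

Definition passes (T : eqType) (s : seq T) (a p b : T) : bool :=
  infix [:: a; p; b] s || infix [:: b; p; a] s.

Lemma passesC (T : eqType) (s : seq T) a p b : passes s a p b = passes s b p a.
Proof. by rewrite /passes orbC. Qed.

Lemma passes_cons (T : eqType) x (s : seq T) a p b : passes s a p b -> passes (x :: s) a p b.
Proof. by case/orP => h; rewrite /passes !infix_consl h !orbT. Qed.

Lemma consec_head (T : eqType) x (s : seq T) b : uniq (x :: s) -> consec (x :: s) x b ->
  exists s', s = b :: s'.
Proof.
case: s => [|y s]; first by rewrite consec1.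
case/andP => xs _; rewrite consec_cons2 eqxx /= => /or3P[/eqP->|/andP[/eqP xy _]|].
- by exists s.
- by rewrite xy mem_head in xs.
- by move/consec_mem/andP => [xs' _]; rewrite xs' in xs.
Qed.

(** In a sequence without repetition an entry has at most two neighbours, one before and one after
    it. *)
Lemma passesP (T : eqType) (s : seq T) a p b : uniq s ->
  passes s a p b = [&& a != b, consec s a p & consec s p b].
Proof.
move=> us; apply/idP/idP => [|/and3P[ab]].
  have H x y : infix [:: x; p; y] s -> [&& x != y, consec s x p & consec s p y].
    case/infixP=> [s1 [s2 es]]; move: us; rewrite es cat_uniq => /and3P[_ _ /= /and3P[+ _ _]].
    rewrite !inE !negb_or => /and3P[_ -> _] /=.
    by rewrite !consec_cat // !consec_cons2 !eqxx ?orbT.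
  by case/orP => /H // /and3P[ba bp pa]; rewrite eq_sym ba consecC pa consecC bp.
elim: s us => [|x [|y s] IH] us //; first by rewrite consec1.
have /andP[xs us'] := us; rewrite !(consec_cons2 _ x).
have notx t u : consec (y :: s) t u -> (t != x) && (u != x).
  by move/consec_mem/andP => [ts us'']; apply/andP; split; apply: contraNneq xs => <-.
have xy : x != y by apply: contraNneq xs => ->; rewrite mem_head.
case/or3P=> [/andP[/eqP ea /eqP ep]|/andP[/eqP ea /eqP ep]|tap];
  case/or3P=> [/andP[/eqP ep' /eqP eb]|/andP[/eqP ep' /eqP eb]|tpb].
- by rewrite -ep' ep eqxx in xy.
- by rewrite ea eb eqxx in ab.
- rewrite ep in tpb *; have [s' ->] := consec_head us' tpb.
  by rewrite ea /passes infix_consl !prefix_cons !eqxx prefix0s.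
- by rewrite ea eb eqxx in ab.
- by rewrite -ep' ep eqxx in xy.
- by have := notx _ _ tpb; rewrite ep eqxx.
- by have := notx _ _ tap; rewrite ep' eqxx andbF.
- rewrite ep' consecC in tap *; have [s' ->] := consec_head us' tap.
  by rewrite eb /passes orbC infix_consl !prefix_cons !eqxx prefix0s.
- exact/passes_cons/IH.
Qed.

Lemma consec_grid_adj (s : seq gpoint) a b : sorted grid_adj s -> consec s a b -> grid_adj a b.
Proof.
have adjC : symmetric grid_adj.
  by move=> x y; rewrite /grid_adj distrC (distrC x.2).
move=> srt /orP[] /infixP[s1 [s2 es]]; move: srt; rewrite es => /cat_sorted2[_ /= /andP[+ _]] //.
by rewrite adjC.
Qed.

(** * Paths in the grid cut at its points *)

Section Nodes.
Variable side : gpoint -> gpoint -> bool.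

Definition gnode : Type := (gpoint + gpoint * bool)%type.

(** Twice the midpoint determines a grid edge. *)
Definition edge_node (a b : gpoint) : gnode := inl (a.1 + b.1, a.2 + b.2)%R.

Definition side_node (p a : gpoint) : gnode := inr (p, side p a).

Definition corner (a p b : gpoint) : seq gnode :=
  if side p a == side p b then [:: side_node p a] else [:: side_node p a; side_node p b].

(** Only inner points of a path contribute side nodes, so a path that merely ends at a point does
    not meet other paths there. *)
Fixpoint nodes (s : seq gpoint) : seq gnode :=
  if s is a :: (b :: s') as t then
    edge_node a b :: (if s' is c :: _ then corner a b c else [::]) ++ nodes t
  else [::].

Lemma edge_nodeC a b : edge_node a b = edge_node b a.
Proof. by rewrite /edge_node addrC (addrC a.2). Qed.

Lemma edge_node_inj a b c d : grid_adj a b -> grid_adj c d ->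
  edge_node a b = edge_node c d -> (a = c /\ b = d) \/ (a = d /\ b = c).
Proof.
case: a b c d => [a1 a2] [b1 b2] [c1 c2] [d1 d2]; rewrite /grid_adj /= => ab cd [e1 e2].
have [[h1 [h2 [h3 h4]]]|[h1 [h2 [h3 h4]]]] : (a1 = c1 /\ a2 = c2 /\ b1 = d1 /\ b2 = d2) \/
  (a1 = d1 /\ a2 = d2 /\ b1 = c1 /\ b2 = c2) by lia.
  by left; rewrite h1 h2 h3 h4.
by right; rewrite h1 h2 h3 h4.
Qed.

Lemma mem_corner x a p b : (x \in corner a p b) = (x == side_node p a) || (x == side_node p b).
Proof.
rewrite /corner; case: eqVneq => [e|_]; rewrite !inE //.
by rewrite /side_node e orbb.
Qed.

Lemma mem_nodes (s : seq gpoint) x : x \in nodes s ->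
  (exists a b, consec s a b /\ x = edge_node a b) \/
  (exists a p b, passes s a p b /\ x = side_node p a).
Proof.
elim: s => [|a [|b s] IH] //=; rewrite inE mem_cat => /or3P[/eqP->|xc|/IH].
- by left; exists a, b; rewrite consec_cons2 !eqxx.
- case: s xc {IH} => [|c s] //; rewrite mem_corner => /orP[] /eqP->; right.
    by exists a, b, c; rewrite /passes infix_consl !prefix_cons !eqxx prefix0s.
  by exists c, b, a; rewrite /passes orbC infix_consl !prefix_cons !eqxx prefix0s.
- case=> [[c [d [cd ->]]]|[c [p [d [cd ->]]]]].
    by left; exists c, d; rewrite consec_cons.
  by right; exists c, p, d; rewrite passes_cons.
Qed.

Lemma nodes_cons a s x : x \in nodes s -> x \in nodes (a :: s).
Proof. by case: s => [|b s] //= xs; rewrite inE mem_cat xs !orbT. Qed.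

Lemma edge_node_mem s a b : consec s a b -> edge_node a b \in nodes s.
Proof.
elim: s => [|c [|d s] IH]; [by rewrite /consec /=|by rewrite consec1|].
rewrite consec_cons2 => /or3P[/andP[/eqP-> /eqP->]|/andP[/eqP-> /eqP->]|/IH].
- exact: mem_head.
- by rewrite edge_nodeC mem_head.
- exact: nodes_cons.
Qed.

Lemma nodes_infix a p b s : infix [:: a; p; b] s ->
  infix (edge_node a p :: corner a p b ++ [:: edge_node p b]) (nodes s).
Proof.
elim: s => [//|x [|y s] IH]; first by rewrite infixs1 /= eqseq_cons andbF.
rewrite infix_consl => /orP[|/IH h]; last first.
  rewrite (_ : nodes [:: x, y & s] = (edge_node x y ::
    (if s is c :: _ then corner x y c else [::])) ++ nodes (y :: s)) //.
  exact: infix_catl.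
rewrite !prefix_cons => /and3P[/eqP<- /eqP<-]; case: s {IH} => [//|z s].
rewrite prefix_cons => /andP[/eqP<- _]; apply: prefixW; rewrite /= eqxx /=.
by rewrite cats1 -cat_rcons prefix_prefix.
Qed.

Lemma passes_side_node s a p b : passes s a p b ->
  consec (nodes s) (edge_node a p) (side_node p a) /\
  consec (nodes s) (edge_node p b) (side_node p b).
Proof.
wlog h : a b / infix [:: a; p; b] s.
  move=> H /orP[h|h]; first by apply: H; rewrite ?h // /passes h.
  have [] := H _ _ h; first by rewrite /passes h.
  by rewrite edge_nodeC => ? ; rewrite edge_nodeC.
move=> _; have := nodes_infix h; rewrite /consec /corner; case: eqVneq => [e|_] /= h'.
  split; apply/orP; [left|right]; apply: infix_trans h'; rewrite /side_node -?e ?infix_consl;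
  by rewrite !prefix_cons !eqxx prefix0s ?orbT.
by split; apply/orP; [left|right]; apply: infix_trans h'; rewrite !infix_consl !prefix_cons !eqxx prefix0s ?orbT.
Qed.

Lemma passes_sides s a p b : passes s a p b -> side p a != side p b ->
  consec (nodes s) (side_node p a) (side_node p b).
Proof.
move=> + ne; wlog h : a b ne / infix [:: a; p; b] s.
  move=> H /orP[h|h]; first by apply: H; rewrite ?h // /passes h.
  by rewrite consecC; apply: H; rewrite // 1?eq_sym // /passes h.
move=> _; have := nodes_infix h; rewrite /consec /corner (negPf ne) /= => h'.
by apply/orP; left; apply: infix_trans h'; rewrite !infix_consl !prefix_cons !eqxx prefix0s ?orbT.
Qed.

Lemma uniq_nodes s : sorted grid_adj s -> uniq s -> uniq (nodes s).
Proof.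
elim: s => [|a [|b s] IH] // srt us.
have srt' : sorted grid_adj (b :: s) by case/andP: srt.
have us' : uniq (b :: s) by case/andP: us.
rewrite [nodes _]/= cons_uniq cat_uniq (IH srt' us') andbT mem_cat negb_or -!andbA.
apply/and4P; split.
- by case: s {IH srt srt' us us'} => [|c s] //; rewrite mem_corner.
- apply/negP => xn; case: (mem_nodes (xn : _ \in nodes (b :: s))) => [[c [d [cd e]]]|[c [p [d [_]]]]] //.
  have ab : grid_adj a b by case/andP: srt.
  have /andP[cs ds] := consec_mem cd.
  have [[ac _]|[ad _]] := edge_node_inj ab (consec_grid_adj srt' cd) e.
    by case/andP: us; rewrite ac cs.
  by case/andP: us; rewrite ad ds.
- case: s {IH srt srt' us us'} => [|c s] //; rewrite /corner; case: eqVneq => //= ne.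
  by rewrite inE andbT; apply: contraNneq ne => -[->].
- apply/hasPn => x xn; case: (mem_nodes (xn : x \in nodes (b :: s))) => [[c [d [_ ->]]]|[c [p [d [+ ->]]]]].
    by case: (s) => [|z s'] //=; rewrite mem_corner.
  rewrite passesP // => /and3P[ncd cp pd]; apply/negP => /= h.
  (* A side node of [b] occurring later would require two neighbours of [b] in [b :: s], where [b]
     comes first and has at most one. *)
  have pb : p = b by case: (s) h => [|z s'] //; rewrite mem_corner => /orP[] /eqP[].
  rewrite pb consecC in cp; rewrite pb in pd.
  have [s1 e1] := consec_head us' cp; have [s2 e2] := consec_head us' pd.
  by move: e1 ncd; rewrite e2 => -[->]; rewrite eqxx.
Qed.

End Nodes.

Lemma consec_map (T T' : eqType) (f : T -> T') s x y :
  consec s x y -> consec (map f s) (f x) (f y).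
Proof.
by case/orP=> /infixP[s1 [s2 ->]]; rewrite map_cat consec_cat // consec_cons2 !eqxx ?orbT.
Qed.

(** * Crossings at a grid point *)

Lemma neighbors4 (p a b c d q : gpoint) : uniq [:: a; b; c; d] ->
  all (grid_adj^~ p) [:: a; b; c; d] -> grid_adj q p -> q \in [:: a; b; c; d].
Proof.
pose nbrs : seq gpoint :=
  [:: (p.1 + 1, p.2); (p.1 - 1, p.2); (p.1, p.2 + 1); (p.1, p.2 - 1)]%R.
have nbrsP r : grid_adj r p -> r \in nbrs.
  case: r => r1 r2; rewrite /grid_adj /nbrs !inE !xpair_eqE /=; clear; lia.
move=> un /allP adj4 /nbrsP qn.
have sub : {subset [:: a; b; c; d] <= nbrs} by move=> r /adj4/nbrsP.
by have [_ ->] := uniq_min_size un sub isT.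
Qed.

Lemma chordal_no_C4 (G : sgraph) (x y z t : G) : chordal G ->
  adj x y -> adj y z -> adj z t -> adj t x -> x != z -> y != t ->
  ~~ adj x z -> ~~ adj y t -> False.
Proof.
move=> chG xy yz zt tx nxz nyt axz ayt.
have ne (u v : G) : adj u v -> u != v by apply: contraTneq => ->; rewrite adj_irr.
have [nxy nyz nzt ntx] := And4 (ne _ _ xy) (ne _ _ yz) (ne _ _ zt) (ne _ _ tx).
have nxt : x != t by rewrite eq_sym.
apply: (chG [:: x; y; z; t]) => //; split.
  rewrite /ucycle /= xy yz zt tx /= !inE !negb_or nxy nxz nxt nyz nyt nzt //.
move=> u v; rewrite !inE /= => /or4P[] /eqP-> /or4P[] /eqP->;
  rewrite ?adj_irr ?(negPf axz) ?(negPf ayt) // 1?adj_sym ?(negPf axz) ?(negPf ayt) //= => _;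
  rewrite ?eqxx ?(eq_sym y x) ?(eq_sym z x) ?(eq_sym z y) ?(eq_sym t x) ?(eq_sym t y) ?(eq_sym t z)
    ?(negPf nxy) ?(negPf nxz) ?(negPf nxt) ?(negPf nyz) ?(negPf nyt) ?(negPf nzt) ?eqxx /=; auto.
Qed.

Section ChordalB1.
Variables (G : sgraph) (P : G -> seq gpoint) (L : G -> ell).
Hypothesis chG : chordal G.
Hypothesis P_path : forall v, is_path grid_adj (P v).
Hypothesis P_ell : forall v a b, consec (P v) a b = ell_edge (L v) a b.
Hypothesis P_adj : forall u v, u != v -> adj u v <-> share (L u) (L v).

Lemma P_uniq v : uniq (P v).
Proof. by case/and3P: (P_path v). Qed.

Lemma P_grid v a b : consec (P v) a b -> grid_adj a b.
Proof. by case/and3P: (P_path v) => _ srt _; apply: consec_grid_adj. Qed.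

Lemma P_share u v a b : consec (P u) a b -> consec (P v) a b -> share (L u) (L v).
Proof. by rewrite !P_ell => ua va; apply/ell_edge_share; exists a, b; rewrite ua. Qed.

Lemma passes_edges v a p b : passes (P v) a p b ->
  [/\ a != b, consec (P v) a p & consec (P v) b p].
Proof. by rewrite passesP ?P_uniq // (consecC _ p) => /and3P[]. Qed.

Lemma passes_cross u v a b c d p : passes (P u) a p b -> passes (P v) c p d ->
  uniq [:: a; b; c; d] -> ~ share (L u) (L v).
Proof.
move=> /passes_edges[_ ua ub] /passes_edges[_ vc vd] un.
by apply: (ell_cross (p := p) un); rewrite -P_ell.
Qed.

(** The second crossing pairs the four edges at [p] differently, so each of its paths shares an edge
    with [u0] and an edge with [v0]. Then [u0], [u], [v0], [v] is an induced 4-cycle, opposite paths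
    being disjoint by [ell_cross]. *)
Lemma no_crossing_pairs u0 v0 u v a b c d a' b' c' d' p :
  passes (P u0) a p b -> passes (P v0) c p d -> uniq [:: a; b; c; d] ->
  passes (P u) a' p b' -> passes (P v) c' p d' -> uniq [:: a'; b'; c'; d'] ->
  a' \in [:: a; b] -> b' \in [:: c; d] -> c' \in [:: a; b] -> d' \in [:: c; d] -> False.
Proof.
move=> hu0 hv0 un hu hv un' a'ab b'cd c'ab d'cd.
have nu0v0 := passes_cross hu0 hv0 un; have nuv := passes_cross hu hv un'.
have [_ u0a u0b] := passes_edges hu0; have [_ v0c v0d] := passes_edges hv0.
have [_ ua ub] := passes_edges hu; have [_ vc vd] := passes_edges hv.
have in_u0 q : q \in [:: a; b] -> consec (P u0) q p by rewrite !inE => /orP[] /eqP->.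
have in_v0 q : q \in [:: c; d] -> consec (P v0) q p by rewrite !inE => /orP[] /eqP->.
have s1 := P_share (in_u0 _ a'ab) ua; have s2 := P_share ub (in_v0 _ b'cd).
have s3 := P_share (in_v0 _ d'cd) vd; have s4 := P_share vc (in_u0 _ c'ab).
have s5 := P_share u0a u0a; have s6 := P_share ua ua.
have nadj x y : ~ share (L x) (L y) -> ~~ adj x y.
  move=> nsh; apply/negP => xy; apply/nsh/P_adj => //.
  by apply: contraTneq xy => ->; rewrite adj_irr.
have ne x y z : share (L x) (L z) -> ~ share (L y) (L z) -> x != y.
  by move=> xz nyz; apply/eqP => e; rewrite e in xz.
have [nvu nv0u0] : ~ share (L v) (L u) /\ ~ share (L v0) (L u0) by rewrite !(shareC _ (L u)) !(shareC _ (L u0)).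
have [s1' s2'] := (proj1 (shareC _ _) s1, proj1 (shareC _ _) s2).
have [s3' s4'] := (proj1 (shareC _ _) s3, proj1 (shareC _ _) s4).
have a1 : adj u0 u by apply/P_adj => //; apply: ne s4' nuv.
have a2 : adj u v0 by apply/P_adj => //; apply: ne s1' nv0u0.
have a3 : adj v0 v by apply/P_adj => //; apply: ne s2' nvu.
have a4 : adj v u0 by apply/P_adj => //; apply: ne s3' nu0v0.
exact: (chordal_no_C4 chG a1 a2 a3 a4 (ne _ _ _ s5 nv0u0) (ne _ _ _ s6 nvu) (nadj _ _ nu0v0) (nadj _ _ nuv)).
Qed.

(** One crossing at [p], if there is any, defines the sides. Every other crossing uses the same four
    edges and, by [no_crossing_pairs], the same pairing. *)
Lemma exists_side p : exists sd : gpoint -> bool, forall u v a b c d,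
  passes (P u) a p b -> passes (P v) c p d -> uniq [:: a; b; c; d] ->
  [/\ sd a = sd b, sd c = sd d & sd a != sd c].
Proof.
pose X := seq_sub (flatten [seq P v | v <- enum G]).
have inX v a : a \in P v -> exists x : X, val x = a.
  move=> av; have aX : a \in flatten [seq P v | v <- enum G].
    by apply/flattenP; exists (P v) => //; apply: map_f; rewrite mem_enum.
  by exists (Sub a aX); rewrite SubK.
pose crossing (t : G * G * (X * X * X * X)) : bool :=
  let: (u, v, (a, b, c, d)) := t in
  [&& passes (P u) (val a) p (val b), passes (P v) (val c) p (val d)
    & uniq [:: val a; val b; val c; val d]].
case: (pickP crossing) => [[[u0 v0] [[[a b] c] d]] /and3P[hu0 hv0 un]|none]; last first.
  exists (fun=> true) => u v a b c d hu hv un.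
  have [_ /consec_mem/andP[au _] /consec_mem/andP[bu _]] := passes_edges hu.
  have [_ /consec_mem/andP[cv _] /consec_mem/andP[dv _]] := passes_edges hv.
  have [[a' ea] [b' eb]] := (inX _ _ au, inX _ _ bu).
  have [[c' ec] [d' ed]] := (inX _ _ cv, inX _ _ dv).
  have := none (u, v, (a', b', c', d')); case/negP.
  by apply/and3P; rewrite ea eb ec ed.
move: (val a) (val b) (val c) (val d) hu0 hv0 un => {}a {}b {}c {}d hu0 hv0 un.
pose sd q := q \in [:: a; b]; exists sd => u v a' b' c' d' hu hv un'.
have [_ u0a u0b] := passes_edges hu0; have [_ v0c v0d] := passes_edges hv0.
have [_ ua ub] := passes_edges hu; have [_ vc vd] := passes_edges hv.
have nbrs : all (grid_adj^~ p) [:: a; b; c; d].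
  by rewrite /= (P_grid u0a) (P_grid u0b) (P_grid v0c) (P_grid v0d).
have sub : {subset [:: a'; b'; c'; d'] <= [:: a; b; c; d]}.
  move=> q qin; apply: neighbors4 un nbrs _; move: qin; rewrite !inE => /or4P[] /eqP->.
  - exact: P_grid ua. - exact: P_grid ub. - exact: P_grid vc. - exact: P_grid vd.
have perm4 : perm_eq [:: a'; b'; c'; d'] [:: a; b; c; d].
  by apply: uniq_perm => //; have [] := uniq_min_size un' sub isT.
(* Counting shows that exactly two of [a'], [b'], [c'], [d'] are on the side of [a] and [b]; if
   these are not paired with each other, the four mixed cases below give a contradiction. *)
have /permP/(_ sd) := perm4.
have [sda sdb] : sd a /\ sd b by rewrite /sd !inE !eqxx orbT.
have [sdc sdd] : sd c = false /\ sd d = false.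
  move: un; rewrite /sd /= !inE !negb_or => /and4P[/and3P[_ ac ad] /andP[bc bd] _ _].
  by rewrite !(eq_sym c) !(eq_sym d) (negPf ac) (negPf ad) (negPf bc) (negPf bd).
have sdF q : q \in [:: a'; b'; c'; d'] -> sd q = false -> q \in [:: c; d].
  by move/sub; rewrite /sd !inE orbA => /orP[->|].
rewrite /= sda sdb sdc sdd.
have bad := no_crossing_pairs hu0 hv0 un.
have p4 : [/\ a' \in [:: a'; b'; c'; d'], b' \in [:: a'; b'; c'; d'],
    c' \in [:: a'; b'; c'; d'] & d' \in [:: a'; b'; c'; d']] by rewrite !inE !eqxx !orbT.
case: p4 => /sdF ina /sdF inb /sdF inc /sdF ind.
have unba : uniq [:: b'; a'; c'; d'] by rewrite (perm_uniq (_ : perm_eq _ [:: a'; b'; c'; d'])) // (perm_catCA [:: b'] [:: a'] [:: c'; d']).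
have undc q r : uniq [:: q; r; c'; d'] -> uniq [:: q; r; d'; c'].
  by rewrite (perm_uniq (_ : perm_eq [:: q; r; d'; c'] [:: q; r; c'; d'])) // !perm_cons (perm_catC [:: d'] [:: c']).
rewrite passesC in hu; have hu' := hu; rewrite passesC in hu.
rewrite passesC in hv; have hv' := hv; rewrite passesC in hv.
case Ea : (sd a'); case Eb : (sd b'); case Ec : (sd c'); case Ed : (sd d') => //= _.
- by case: (bad _ _ _ _ _ _ hu hv un' Ea (inb Eb) Ec (ind Ed)).
- by case: (bad _ _ _ _ _ _ hu hv' (undc _ _ un') Ea (inb Eb) Ed (inc Ec)).
- by case: (bad _ _ _ _ _ _ hu' hv unba Eb (ina Ea) Ec (ind Ed)).
- by case: (bad _ _ _ _ _ _ hu' hv' (undc _ _ unba) Eb (ina Ea) Ed (inc Ec)).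
Qed.

Lemma exists_sides : exists side : gpoint -> gpoint -> bool, forall p u v a b c d,
  passes (P u) a p b -> passes (P v) c p d -> uniq [:: a; b; c; d] ->
  [/\ side p a = side p b, side p c = side p d & side p a != side p c].
Proof.
pose X := seq_sub (flatten [seq P v | v <- enum G]).
have /fin_all_exists[sd sdP] : forall x : X, _ := fun x => exists_side (val x).
(* The default [xpredT] concerns only points on no path, where nothing passes. *)
exists (fun p => oapp sd xpredT (insub p)) => p u v a b c d hu hv un.
have px : p \in flatten [seq P v | v <- enum G].
  apply/flattenP; exists (P u); first by apply: map_f; rewrite mem_enum.
  by have [_ /consec_mem/andP[]] := passes_edges hu.
rewrite insubT /=; apply: (sdP (Sub p px)) hu hv un.
Qed.

(** * Intersections of the cut paths *)

Section Sides.
Variable side : gpoint -> gpoint -> bool.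
Hypothesis sideP : forall p u v a b c d,
  passes (P u) a p b -> passes (P v) c p d -> uniq [:: a; b; c; d] ->
  [/\ side p a = side p b, side p c = side p d & side p a != side p c].

Let nodesP v := nodes side (P v).

Lemma side_node_mem v a p b : passes (P v) a p b -> side_node side p a \in nodesP v.
Proof. by case/(passes_side_node side) => /consec_mem/andP[]. Qed.

Lemma mem_side_node v x p : inr (p, x) \in nodesP v ->
  exists a b, passes (P v) a p b /\ x = side p a.
Proof.
case/mem_nodes => [[a [b []]] //|[a [q [b [ab [ep ex]]]]]].
by exists a, b; rewrite ep.
Qed.

(** Paths with no common edge at [p] would cross there and be put on different sides. *)
Lemma common_neighbor u v a b c d p : passes (P u) a p b -> passes (P v) c p d ->
  side p a = side p c ->
  [\/ a = c, a = d, b = c | b = d].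
Proof.
move=> hu hv sac; have [ab _ _] := passes_edges hu; have [cd _ _] := passes_edges hv.
have [un|] := boolP (uniq [:: a; b; c; d]).
  by have [_ _] := sideP hu hv un; rewrite sac eqxx.
rewrite /= !inE (negPf ab) (negPf cd) /= andbT negb_and !negbK.
case/orP=> /orP[] /eqP->; by [apply: Or41|apply: Or42|apply: Or43|apply: Or44].
Qed.

Lemma mem_edge_node v a b : grid_adj a b -> edge_node a b \in nodesP v -> consec (P v) a b.
Proof.
move=> ab /mem_nodes[[c [d [cd e]]]|[c [p [d []]]] //].
by have [[-> ->]|[-> ->]] := edge_node_inj ab (P_grid cd) e; rewrite // consecC.
Qed.

Section Connected.
Variables (u v : G) (f : gnode -> bool).
Hypothesis f_step : forall x y, consec (nodesP u) x y -> consec (nodesP v) x y -> f x = f y.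

(** Two paths with a common side node share a grid edge at [p], and the nodes from the side node to
    that edge are common to both. *)
Lemma common_side_node p x : inr (p, x) \in nodesP u -> inr (p, x) \in nodesP v ->
  exists a, [/\ consec (P u) a p, consec (P v) a p & f (inr (p, x)) = f (edge_node a p)].
Proof.
move=> /mem_side_node[a [b [hu ea]]] /mem_side_node[c [d [hv ec]]].
have H q r s : passes (P u) q p r -> passes (P v) q p s ->
    f (side_node side p q) = f (edge_node q p).
  move=> h1 h2; symmetry; apply: f_step;
  by [have [] := passes_side_node side h1|have [] := passes_side_node side h2].
(* The shared edge [q p] may lie on the other side of [p]; then both paths switch sides at [p] and
   have the link between the two side nodes in common. *)
have H2 q r s : passes (P u) q p r -> passes (P v) q p s -> side p r = x -> side p s = x ->
    f (inr (p, x)) = f (edge_node q p).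
  move=> h1 h2 rx sx; rewrite -(H _ _ _ h1 h2).
  have [e|ne] := eqVneq (side p q) x; first by rewrite /side_node e.
  rewrite -[inr _]/(inr (p, x)) -{1}rx; symmetry; apply: f_step.
    by apply: (passes_sides h1); rewrite rx.
  by rewrite rx -sx; apply: (passes_sides h2); rewrite sx.
have [_ ua ub] := passes_edges hu; have [_ vc vd] := passes_edges hv.
case: (common_neighbor hu hv); first by rewrite -ea.
- by move=> e; subst c; exists a; split=> //; rewrite ea; apply: H hu hv.
- move=> e; subst d; rewrite passesC in hv; exists a; split=> //.
  by rewrite ea; apply: H hu hv.
- move=> e; subst b; rewrite passesC in hu; exists c; split=> //.
  by rewrite ec; apply: H hu hv.
- move=> e; subst d; exists b; rewrite passesC in hu; rewrite passesC in hv; split=> //.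
  exact: (H2 _ _ _ hu hv).
Qed.

(** Every common node is linked to a common grid edge, and [ell_chain] links the common edges,
    passing through side nodes at each inner point. *)
Lemma common_nodes x y : x \in nodesP u -> x \in nodesP v -> y \in nodesP u -> y \in nodesP v ->
  f x = f y.
Proof.
pose g a b := f (edge_node a b).
have chain : forall a b c d, ell_edge (L u) a b && ell_edge (L v) a b ->
    ell_edge (L u) c d && ell_edge (L v) c d -> g a b = g c d.
  apply: ell_chain => [a b|a p b ab]; first by rewrite /g edge_nodeC.
  rewrite -!P_ell => /andP[uap vap] /andP[upb vpb].
  have hu : passes (P u) a p b by rewrite passesP ?P_uniq // ab uap.
  have hv : passes (P v) a p b by rewrite passesP ?P_uniq // ab vap.
  have [u1 u2] := passes_side_node side hu; have [v1 v2] := passes_side_node side hv.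
  rewrite /g (f_step u1 v1) (f_step u2 v2).
  have [e|ne] := eqVneq (side p a) (side p b); first by rewrite /side_node e.
  by apply: f_step; apply: passes_sides.
have edge z : z \in nodesP u -> z \in nodesP v -> exists a b,
    ell_edge (L u) a b && ell_edge (L v) a b /\ f z = g a b.
  case: z => [z|[p t]] zu zv; last first.
    by have [a [ua va ->]] := common_side_node zu zv; exists a, p; rewrite -!P_ell ua va.
  case: (mem_nodes zu) => [[a [b [ab ->]]]|[a [q [b []]]]] // in zv *.
  by exists a, b; rewrite -!P_ell ab (mem_edge_node (P_grid ab) zv).
move=> xu xv yu yv; have [a [b [ab ->]]] := edge _ xu xv; have [c [d [cd ->]]] := edge _ yu yv.
exact: chain.
Qed.

End Connected.

(** The private node [inl v] keeps a path without edges nonempty. *)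
Definition vertex_nodes (v : G) : seq (G + gnode) := inl v :: map inr (nodesP v).

Lemma inr_vertex_nodes v x : (inr x \in vertex_nodes v) = (x \in nodesP v).
Proof. by rewrite inE /= mem_map // => ? ? []. Qed.

Lemma inl_vertex_nodes v w : (inl w \in vertex_nodes v) = (w == v).
Proof. by rewrite inE orbC; case: mapP => [[? _] //|_]; apply/eqP/eqP => [[]|->]. Qed.

Lemma vertex_nodes_adj u v : u != v ->
  adj u v <-> exists x, (x \in vertex_nodes u) && (x \in vertex_nodes v).
Proof.
move=> uv; rewrite P_adj //; split=> [/ell_edge_share[a [b]]|[[w|x]]].
- rewrite -!P_ell => /andP[ua va]; exists (inr (edge_node a b)).
  by rewrite !inr_vertex_nodes !edge_node_mem.
- by rewrite !inl_vertex_nodes => /andP[/eqP-> e]; rewrite (negPf uv) in e.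
rewrite !inr_vertex_nodes; case: x => [z|[p t]] /andP[xu xv].
  case: (mem_nodes xu) => [[a [b [ab e]]]|[a [q [b []]]]] //; rewrite e in xv.
  exact: (P_share ab (mem_edge_node (P_grid ab) xv)).
have [a [b [hu ea]]] := mem_side_node xu; have [c [d [hv ec]]] := mem_side_node xv.
have [_ ua ub] := passes_edges hu; have [_ vc vd] := passes_edges hv.
case: (common_neighbor hu hv); first by rewrite -ea.
- by move=> e; rewrite -e in vc; apply: P_share ua vc.
- by move=> e; rewrite -e in vd; apply: P_share ua vd.
- by move=> e; rewrite -e in vc; apply: P_share ub vc.
- by move=> e; rewrite -e in vd; apply: P_share ub vd.
Qed.

(** For a claw at [p], two of its three ends are on the same side of [p]. Each of the three paths
    uses at least one of these two ends, so all three contain that side node. *)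
Lemma vertex_nodes_helly u v w : adj u v -> adj v w -> adj w u ->
  exists x, [&& x \in vertex_nodes u, x \in vertex_nodes v & x \in vertex_nodes w].
Proof.
have sh x y : adj x y -> share (L x) (L y).
  by move=> xy; apply/P_adj => //; apply: contraTneq xy => ->; rewrite adj_irr.
move=> /sh uv /sh vw /sh wu; case: (ell_helly uv vw wu) => [[a [b]]|].
  rewrite -!P_ell => /and3P[ua va wa]; exists (inr (edge_node a b)).
  by rewrite !inr_vertex_nodes !edge_node_mem.
case=> p [a [b [c [[ab bc ca]]]]]; rewrite -!P_ell => -[/andP[uap upb] /andP[vbp vpc] /andP[wcp wpa]].
have hu : passes (P u) a p b by rewrite passesP ?P_uniq // ab uap.
have hv : passes (P v) b p c by rewrite passesP ?P_uniq // bc vbp.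
have hw : passes (P w) c p a by rewrite passesP ?P_uniq // ca wcp.
have [ua va wc] := And3 (side_node_mem hu) (side_node_mem hv) (side_node_mem hw).
rewrite passesC in hu; rewrite passesC in hv; rewrite passesC in hw.
have [ub vc wa] := And3 (side_node_mem hu) (side_node_mem hv) (side_node_mem hw).
have [e|nab] := eqVneq (side p a) (side p b).
  exists (inr (side_node side p a)); rewrite !inr_vertex_nodes ua wa /side_node e.
  by rewrite -/(side_node side p b) va.
have [e|nbc] := eqVneq (side p b) (side p c).
  exists (inr (side_node side p b)); rewrite !inr_vertex_nodes ub va /side_node e.
  by rewrite -/(side_node side p c) wc.
have e : side p c = side p a by case: (side p a) (side p b) (side p c) nab nbc => [] [] [].
exists (inr (side_node side p a)); rewrite !inr_vertex_nodes ua wa /side_node -e.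
by rewrite -/(side_node side p c) vc.
Qed.

Lemma vertex_nodes_connected u v (f : G + gnode -> bool) : u != v ->
  (forall x y, consec (vertex_nodes u) x y -> consec (vertex_nodes v) x y -> f x = f y) ->
  {in [predI vertex_nodes u & vertex_nodes v] &, forall x y, f x = f y}.
Proof.
move=> uv fE.
have fE' x y : consec (nodesP u) x y -> consec (nodesP v) x y -> f (inr x) = f (inr y).
  by move=> xyu xyv; apply: fE; apply/consec_cons/consec_map.
have notl w : inl w \in vertex_nodes u -> inl w \in vertex_nodes v -> False.
  by rewrite !inl_vertex_nodes => /eqP-> e; rewrite (negPf uv) in e.
move=> [w|x] [t|y] /andP[xu xv] /andP[yu yv]; try by case: (notl _ xu xv).
  by case: (notl _ yu yv).
rewrite /= !inr_vertex_nodes in xu xv yu yv.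
exact: (common_nodes (f := f \o inr) fE').
Qed.

Lemma vertex_nodes_uniq v : uniq (vertex_nodes v).
Proof.
rewrite /= map_inj_uniq; last by move=> ? ? [].
by case/and3P: (P_path v) => _ srt un; rewrite uniq_nodes // andbT; apply/mapP => -[].
Qed.

End Sides.

Lemma VPT_of_ells : VPT G.
Proof.
have [side sideP] := exists_sides.
apply: (VPT_of_host (Q := vertex_nodes side) chG) => //.
- exact: vertex_nodes_uniq.
- exact: vertex_nodes_adj.
- exact: vertex_nodes_helly.
- by move=> u v f uv; apply: vertex_nodes_connected.
Qed.

End ChordalB1.

Lemma ells_of_B1 (G : sgraph) (P : G -> seq gpoint) :
  EPG_rep P -> (forall v, bends (P v) <= 1) ->
  exists L : G -> ell, (forall v a b, consec (P v) a b = ell_edge (L v) a b) /\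
    (forall u v : G, u != v -> adj u v <-> share (L u) (L v)).
Proof.
move=> [Ppath Padj] Pbend.
have /fin_all_exists[L LE] : forall v, exists l, forall a b, uses_edge (P v) a b = ell_edge l a b.
  by move=> v; apply: ell_of_path.
exists L; split=> // u v uv; rewrite -ell_edge_share (Padj _ _ uv).
by split=> -[a [b ab]]; exists a, b; move: ab; rewrite !LE.
Qed.

Lemma chordal_B1_EPG_VPT (G : sgraph) : chordal G -> Bk_EPG 1 G -> VPT G.
Proof.
move=> chG [P [repP bendP]]; have [L [LE Ladj]] := ells_of_B1 repP bendP.
exact: (VPT_of_ells chG (proj1 repP) LE Ladj).
Qed.

(** * A star-shaped VPT graph without a one-bend representation *)

Section Star.
Variable n : nat.

Definition star_rel (x y : option 'I_n) : bool := (x == None) (+) (y == None).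

Lemma star_sym : symmetric star_rel.
Proof. by move=> x y; rewrite /star_rel addbC. Qed.

Lemma star_irr : irreflexive star_rel.
Proof. by move=> x; rewrite /star_rel addbb. Qed.

Definition star : sgraph := SGraph star_sym star_irr.

Lemma star_tree : is_tree star.
Proof.
split; first by apply/card_gt0P; exists None.
- have toNone (x : option 'I_n) : connect star_rel x None.
    by case: x => [x|]; [apply: connect1 | apply: connect0].
  by move=> x y; apply: connect_trans (toNone x) _; rewrite (sym_connect_sym star_sym).
- case=> [|x [|y [|z l]]] //= _ /andP[/= /and3P[xy yz pl] /and4P[]].
  rewrite !inE !negb_or => /and3P[nxy nxz xl] /andP[nyz yl] zl _.
  (* A leaf is adjacent to the centre only, but [y] has the two distinct neighbours [x] and [z]. *)
  have yN : y = None.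
    case: y xy yz {nxy nyz yl} => //= y xy yz.
    by case: x z xy yz nxz {xl zl pl} => [x|] [z|].
  subst y; case: l pl xl yl zl => [|t l] /=.
    by case: x z nxy nyz {xy yz nxz} => [x|] [z|].
  rewrite !inE !negb_or => /andP[zt _] _ /andP[nt _] _.
  by case: z t zt nt nyz {yz nxz} => [z|] [t|].
Qed.

(** Pairs are ordered, so two leaves are joined by two equal paths, given by different vertices;
    [(i, i)] stands for the edge at leaf [i]. The path of any pair contains the centre. *)
Definition star_path (v : 'I_n + 'I_n * 'I_n) : seq (option 'I_n) :=
  match v with
  | inl i => [:: Some i]
  | inr (i, j) => if i == j then [:: None; Some i] else [:: Some i; None; Some j]
  end.

Definition star_graph_rel (u v : 'I_n + 'I_n * 'I_n) : bool :=
  (u != v) && has (mem (star_path u)) (star_path v).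

Lemma star_graph_sym : symmetric star_graph_rel.
Proof. by move=> u v; rewrite /star_graph_rel eq_sym has_sym. Qed.

Lemma star_graph_irr : irreflexive star_graph_rel.
Proof. by move=> u; rewrite /star_graph_rel eqxx. Qed.

Definition star_graph : sgraph := SGraph star_graph_sym star_graph_irr.

Lemma star_graph_VPT : VPT star_graph.
Proof.
exists star, star_path; split; first exact: star_tree.
split=> [[i|[i j]] //=|u v uv].
  case: eqVneq => [//|ij]; rewrite /is_path /= !inE andbT.
  by apply/eqP => -[eij]; rewrite eij eqxx in ij.
rewrite /adj /= /star_graph_rel uv /=; split=> [/hasP[x xv xu]|[x /andP[xu xv]]].
  by exists x; rewrite xv andbT.
by apply/hasP; exists x.
Qed.

Lemma star_leaf_adj i j : star_graph_rel (inl i) (inl j) = false.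
Proof.
rewrite /star_graph_rel /= orbF inE; apply/negbTE/andP => -[ij /eqP[ji]].
by rewrite ji eqxx in ij.
Qed.

Lemma star_edge_adj u v : star_graph_rel (inr u) (inr v) = (u != v).
Proof.
rewrite /star_graph_rel (_ : (inr u != inr v) = (u != v)) //.
case: eqVneq => // _; case: u v => [i j] [k l]; apply/hasP; exists None => /=; by case: ifP.
Qed.

Lemma star_leaf_edge_adj i u : star_graph_rel (inl i) (inr u) = (i == u.1) || (i == u.2).
Proof.
case: u => j k; rewrite /star_graph_rel /=; case: ifP => /= [/eqP->|_]; rewrite !inE orbF.
  by rewrite orbb; apply/eqP/eqP => [[->]|->].
by congr (_ || _); apply/eqP/eqP => [[->]|->].
Qed.

End Star.

(** * Leaf paths on a common line *)

Section StarEll.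
Variables (n : nat) (S : 'I_n -> ell) (K : 'I_n * 'I_n -> ell).
Hypothesis SS : forall i j, i != j -> ~ share (S i) (S j).
Hypothesis KS : forall u i, share (K u) (S i) <-> (i == u.1) || (i == u.2).

(** Of three disjoint leaf paths in one row, one lies between the others, and the path joining the
    outer two contradicts [share_betweenH]. *)
Lemma row_le2 r : (#|[pred i | has_row (S i) r]| <= 2)%N.
Proof.
rewrite leqNgt; apply/negP => /card_gt2P[i [j [k [[+ + +] [ij jk ki]]]]].
rewrite !inE => /has_rowP[a ai] /has_rowP[b bj] /has_rowP[c ck].
have lt3 p q s x y z : p != q -> q != s -> s != p ->
    onH (S p) x r -> onH (S q) y r -> onH (S s) z r -> (x < y)%R -> (y < z)%R -> False.
  move=> pq qs sp hx hy hz xy yz.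
  apply: (share_betweenH (k := K (p, s)) hx hy hz xy yz (SS pq) (SS qs)).
  - by move/KS => /= /orP[] e; [rewrite eq_sym e in pq|rewrite e in qs].
  - by rewrite KS /= eqxx.
  - by rewrite KS /= eqxx orbT.
have ne p q x y : p != q -> onH (S p) x r -> onH (S q) y r -> x != y.
  move=> pq hx hy; apply/negP => /eqP xy; apply: (SS pq); left; exists x, r.
  by rewrite hx xy.
have := ne _ _ _ _ ij ai bj; have := ne _ _ _ _ jk bj ck; have := ne _ _ _ _ ki ck ai.
have ji : j != i by rewrite eq_sym.
have kj : k != j by rewrite eq_sym.
have ik : i != k by rewrite eq_sym.
(* The six instances cover all orders of the three distinct positions. *)
have := lt3 _ _ _ _ _ _ ij jk ki ai bj ck; have := lt3 _ _ _ _ _ _ ik kj ji ai ck bj.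
have := lt3 _ _ _ _ _ _ ji ik kj bj ai ck; have := lt3 _ _ _ _ _ _ jk ki ij bj ck ai.
have := lt3 _ _ _ _ _ _ ki ij jk ck ai bj; have := lt3 _ _ _ _ _ _ kj ji ik ck bj ai.
clear; lia.
Qed.

End StarEll.

(** [S i] is the path of the [i]-th leaf, [K (i, j)] that of the path from leaf [i]
    to leaf [j]; those [S i] using neither line of [K u0] are not [near]. *)
Lemma no_star_ell (S : 'I_7 -> ell) (K : 'I_7 * 'I_7 -> ell) :
  (forall i j, i != j -> ~ share (S i) (S j)) ->
  (forall u i, share (K u) (S i) <-> (i == u.1) || (i == u.2)) ->
  (forall u v, u != v -> share (K u) (K v)) -> False.
Proof.
move=> SS KS KK.
have row2 := row_le2 SS KS.
have col2 r : (#|[pred i | has_row (flip (S i)) r]| <= 2)%N.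
  apply: (row_le2 (S := flip \o S) (K := flip \o K)) => [i j ij|u i] /=.
    by rewrite share_flip; apply: SS.
  by rewrite share_flip; apply: KS.
pose u0 : 'I_7 * 'I_7 := (ord0, ord_max).
pose near := [pred i | has_row (S i) (cy (K u0)) || has_row (flip (S i)) (cx (K u0))].
(* At most two leaf paths use the row of [K u0] and at most two its column, which leaves three of
   the seven. *)
have : (2 < #|[predC near]|)%N.
  rewrite -(ltn_add2l #|near|) cardC card_ord.
  have n4 : (#|near| <= 4)%N; last by rewrite (leq_ltn_trans (leq_add n4 (leqnn 2))).
  apply: leq_trans (leq_add (row2 (cy (K u0))) (col2 (cx (K u0)))).
  by rewrite -cardUI; apply: leq_trans (leq_addr _ _); apply: eq_leq; apply: eq_card.
case/card_gt2P=> [i [j [k [[+ + +] [ij jk ki]]]]]; rewrite !inE => ni nj nk.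
have share0 p : share (K u0) (S p) -> near p.
  by case/share_line=> -[e _ h]; rewrite inE e h ?orbT.
(* [K (p, q)] meets [K u0] on a line that [S p] and [S q] avoid, so it meets both of them on its
   other line, which they therefore have in common. *)
have key p q : p != q -> ~~ near p -> ~~ near q ->
    [/\ cy (S p) = cy (S q), has_row (S p) (cy (S p)) & has_row (S q) (cy (S q))] \/
    [/\ cx (S p) = cx (S q), has_row (flip (S p)) (cx (S p)) & has_row (flip (S q)) (cx (S q))].
  move=> pq np nq.
  have u0p : u0 != (p, q).
    by apply: contraNneq np => e; apply: share0; apply/KS; rewrite e /= eqxx.
  have /share_line Kp : share (K (p, q)) (S p) by apply/KS; rewrite /= eqxx.
  have /share_line Kq : share (K (p, q)) (S q) by apply/KS; rewrite /= eqxx orbT.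
  case: (share_line (KK _ _ u0p)) => -[e0 _ _].
    have nrow r : ~~ near r -> cy (K (p, q)) = cy (S r) -> ~~ has_row (S r) (cy (S r)).
      by move=> nr er; apply: contraNN nr => h; rewrite inE e0 er h.
    case: Kp => [[/(nrow p np)/negPf->]//|[ep _ hp]].
    case: Kq => [[/(nrow q nq)/negPf->]//|[eq _ hq]].
    by right; rewrite -ep -eq in hp hq *.
  have ncol r : ~~ near r -> cx (K (p, q)) = cx (S r) -> ~~ has_row (flip (S r)) (cx (S r)).
    by move=> nr er; apply: contraNN nr => h; rewrite inE e0 er h orbT.
  case: Kp => [[ep _ hp]|[/(ncol p np)/negPf->]//].
  case: Kq => [[eq _ hq]|[/(ncol q nq)/negPf->]//].
  by left; rewrite -ep -eq in hp hq *.
have row3 : has_row (S i) (cy (S i)) -> has_row (S j) (cy (S i)) -> has_row (S k) (cy (S i)) -> False.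
  move=> hi hj hk; have := row2 (cy (S i)); rewrite leqNgt => /negP; apply.
  by apply/card_gt2P; exists i, j, k; rewrite !inE.
have col3 : has_row (flip (S i)) (cx (S i)) -> has_row (flip (S j)) (cx (S i)) ->
    has_row (flip (S k)) (cx (S i)) -> False.
  move=> hi hj hk; have := col2 (cx (S i)); rewrite leqNgt => /negP; apply.
  by apply/card_gt2P; exists i, j, k; rewrite !inE.
(* Two of the three pairs use lines of the same direction; having a leaf path in common, they use
   the same line, which then contains all three. *)
case: (key _ _ ij ni nj) (key _ _ jk nj nk) (key _ _ ki nk ni) => -[e1 hi hj] [] [e2 hj' hk] [] [e3 hk' hi'].
- by apply: (row3 hi); rewrite ?e1 // e2.
- by apply: (row3 hi); rewrite ?e1 // e2.
- by apply: (row3 hi); [rewrite e1 | rewrite -e3].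
- by apply: (col3 hi'); rewrite -e3 // -e2.
- by apply: (row3 hi'); rewrite -e3 // -e2.
- by apply: (col3 hi); [rewrite e1 | rewrite -e3].
- by apply: (col3 hi); rewrite ?e1 // e2.
- by apply: (col3 hi); rewrite ?e1 // e2.
Qed.

Lemma star_graph_not_B1 : ~ Bk_EPG 1 (star_graph 7).
Proof.
case=> P [repP bendP]; have [L [_ adjE]] := ells_of_B1 repP bendP.
apply: (no_star_ell (S := L \o inl) (K := L \o inr)) => [i j ij|u i|u v uv] /=.
- by rewrite -adjE // /adj /= star_leaf_adj.
- by rewrite shareC -adjE // /adj /= star_leaf_edge_adj.
- by apply/adjE => //; rewrite /adj /= star_edge_adj.
Qed.

Theorem theorem3 :
  (forall G : sgraph, chordal G -> Bk_EPG 1 G -> VPT G) /\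
  (exists G : sgraph, VPT G /\ ~ (chordal G /\ Bk_EPG 1 G)).
Proof.
split; first exact: chordal_B1_EPG_VPT.
by exists (star_graph 7); split=> [|[_ /star_graph_not_B1]]; first exact: star_graph_VPT.
Qed.
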